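(* Let $\pi:X\to Y$ be an $n$-cyclic covering of a smooth surface $Y$ with branch divisor $B$, let $P$ be a generic point on the ramification divisor, let $Q=\pi(P)\in B$, and let $(Q_1,\ldots,Q_n)$ be the cluster of infinitely near points with $Q_1=Q$ determined by $B$. Let $C$ be an effective divisor on $Y$. If $D=\pi^*C$ is a divisor passing through $P$ with multiplicity $m$, then $C$ passes through the cluster $(Q_1,\ldots,Q_n)$ with multiplicities $(m_1,\ldots,m_n)$ satisfying $$m=\sum_{i=1}^n m_i.$$
   Context: Surfaces are smooth projective surfaces over the complex numbers. $n$-cyclic covering: let $Y$ be a smooth surface, $\mathcal{O}_Y(M)$ a line bundle on $Y$, and $B\sim nM$ a smooth reduced (nonzero) divisor on $Y$. These data determine the $n$-cyclic covering $\pi:X\to Y$ with branch divisor $B$ (locally $X$ is given by $z^n=b$, with $b$ a local equation of $B$); $X$ is then a smooth surface. The ramification divisor is the reduced divisor $R=\pi^{-1}(B)$. The cluster $(Q_1,\ldots,Q_n)$: put $Y_0=Y$, $Q_1=Q$, $B_0=B$. For $i=1,\ldots,n-1$, let $Y_i$ be the blowing up of $Y_{i-1}$ at $Q_i$, let $E_i$ be its exceptional divisor, let $B_i$ be the strict transform of $B_{i-1}$ in $Y_i$, and let $Q_{i+1}=E_i\cap B_i$. A divisor $C$ passes through the cluster with multiplicities $(m_1,\ldots,m_n)$ if, setting $C_0=C$ and letting $C_i$ be the strict transform of $C_{i-1}$ in $Y_i$, one has $m_{i}=\mathrm{mult}_{Q_{i}}(C_{i-1})$ for $i=1,\ldots,n$.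 *)

(* Defs.v *)
From HB Require Import structures.
From mathcomp Require Import all_boot all_order all_algebra.
From mathcomp Require Import boolp classical_sets reals.
From mathcomp Require Import complex.

Set Implicit Arguments.
Unset Strict Implicit.
Unset Printing Implicit Defensive.

Import Order.TTheory GRing.Theory Num.Theory.
Local Open Scope classical_set_scope.
Local Open Scope ring_scope.

(* Integral schemes are handled in the style of Zariski and Chevalley: a
   (separated) integral scheme with function field K is the set of its local
   rings, each one being a subring of K.  Hence
   - a point is a subring of K, i.e., a [set K] (identified with its local
     ring), and a scheme is a [set (set K)];
   - all scheme-theoretic points are present: K itself is the generic point,
     the local rings of dimension 1 are the prime divisors, and q specializes
     to p iff p `<=` q;
   - a morphism of function fields phi : K -> L maps the point P to the point
     Q iff P dominates the image of Q. *)

Section CommutativeAlgebra.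
Variable K : fieldType.
Implicit Types A I O p S : set K.

Definition subring A : Prop := subring_closed (mem A).

Definition subring_gen S : set K := smallest subring S.

Definition ideal A I : Prop :=
  [/\ I `<=` A, I 0, forall x y, I x -> I y -> I (x + y)
    & forall a x, A a -> I x -> I (a * x)].

Definition ideal_gen A S : set K := smallest (ideal A) S.

Definition ideal_pow A I (k : nat) : set K :=
  ideal_gen A [set \prod_(i < k) a i | a in [set a : 'I_k -> K | forall i, I (a i)]].

Definition prime_ideal A p : Prop :=
  [/\ ideal A p, ~ p 1 & forall x y, A x -> A y -> p (x * y) -> p x \/ p y].

Definition localization A p : set K :=
  [set z | exists a s, [/\ A a, A s, ~ p s & z = a / s]].

(* The local rings of Spec A at the primes containing S. *)
Definition spec_over A S : set (set K) :=
  [set localization A p | p in [set p | prime_ideal A p /\ S `<=` p]].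

Definition spec A : set (set K) := spec_over A set0.

Definition nonunits A : set K := [set x | A x /\ ~ (exists2 y, A y & x * y = 1)].

Definition local_ring A : Prop := subring A /\ ideal A (nonunits A).

Definition noetherian A : Prop :=
  forall I, ideal A I -> exists s : seq K, I = ideal_gen A [set` s].

Definition prime_chain A (d : nat) : Prop :=
  exists p : nat -> set K,
    (forall i, (i <= d)%N -> prime_ideal A (p i)) /\
    (forall i, (i < d)%N -> p i `<` p i.+1).

Definition krull_dim A (d : nat) : Prop := prime_chain A d /\ ~ prime_chain A d.+1.

Definition regular_local_ring A (d : nat) : Prop :=
  [/\ local_ring A, noetherian A, krull_dim A d
    & exists x : 'I_d -> K, nonunits A = ideal_gen A (range x)].

End CommutativeAlgebra.

Section Schemes.
Variable K : fieldType.
Implicit Types (Y U V T : set (set K)) (O p q : set K).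

(* The basic open sets are the loci where finitely many rational functions
   are all regular. *)
Definition zariski_open Y U : Prop :=
  U `<=` Y /\
  forall p, U p -> exists2 s : seq K,
    [set` s] `<=` p & forall q, Y q -> [set` s] `<=` q -> U q.

Definition closed_point Y p : Prop :=
  Y p /\ forall q, Y q -> q `<=` p -> q = p.

(* "prop holds at a generic point of the closed subset T": it holds at every
   closed point of a dense relatively open subset of T. *)
Definition holds_at_generic_point Y T (prop : set K -> Prop) : Prop :=
  exists U, [/\ zariski_open Y U,
    (forall V, zariski_open Y V -> V `&` T !=set0 -> V `&` (U `&` T) !=set0)
    & forall p, closed_point Y p -> (U `&` T) p -> prop p].

(* The coordinate ring of the affine chart x_j != 0 of the projective variety
   with generic homogeneous coordinates (x_0 : ... : x_N). *)
Definition affine_chart (k : fieldType) (iota : k -> K) (N : nat)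
    (x : 'I_N.+1 -> K) (j : 'I_N.+1) : set K :=
  subring_gen (range iota `|` range (fun i => x i / x j)).

Definition projective_variety (k : fieldType) (iota : k -> K) Y : Prop :=
  exists (N : nat) (x : 'I_N.+1 -> K),
    [/\ exists j, x j != 0,
        forall j, x j != 0 -> localization (affine_chart iota x j) [set 0] = setT
      & Y = \bigcup_(j in [set j | x j != 0]) spec (affine_chart iota x j)].

(* Nonsingularity at each closed point; over an algebraically closed field
   this is smoothness. *)
Definition smooth_projective_surface (k : fieldType) (iota : k -> K) Y : Prop :=
  projective_variety iota Y /\ forall p, closed_point Y p -> regular_local_ring p 2.

(* Cartier divisors, encoded as invertible sheaves of fractional ideals: D p
   is the p-submodule of K generated by a local equation of D at p.  The
   values of D outside the scheme are irrelevant. *)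
Definition divisor : Type := set K -> set K.

Implicit Types (B C D M : divisor).

Definition principal O (f : K) : set K := [set f * a | a in O].

Definition local_equation D O (f : K) : Prop := f != 0 /\ D O = principal O f.

Definition cartier_divisor Y D : Prop :=
  forall p, Y p -> exists f U, [/\ zariski_open Y U, U p
                                 & forall q, U q -> local_equation D q f].

Definition effective_divisor Y D : Prop :=
  cartier_divisor Y D /\ forall p, Y p -> D p `<=` p.

Definition supp Y D : set (set K) := [set p | Y p /\ ~ D p 1].

Definition multiplicity D O (m : nat) : Prop :=
  D O `<=` ideal_pow O (nonunits O) m /\ ~ D O `<=` ideal_pow O (nonunits O) m.+1.

(* A point of a curve on a smooth surface is smooth (with the curve reduced
   there) iff it is a simple point. *)
Definition smooth_reduced_divisor Y B : Prop :=
  effective_divisor Y B /\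
  forall p, closed_point Y p -> supp Y B p -> multiplicity B p 1.

(* B ~ n M, B - n M being the divisor of h. *)
Definition linear_equivalence_by Y (n : nat) B M (h : K) : Prop :=
  h != 0 /\ forall O f, Y O -> local_equation M O f ->
    local_equation B O (h * f ^+ n).

End Schemes.

Section Morphisms.
Variables K L : fieldType.
Variable phi : K -> L.

Definition lies_over (Q : set K) (P : set L) : Prop :=
  phi @` Q `<=` P /\ phi @` nonunits Q `<=` nonunits P.

Definition pullback (Y : set (set K)) (C : divisor K) : divisor L :=
  fun P => [set w | exists Q, [/\ Y Q, lies_over Q P & ideal_gen P (phi @` C Q) w]].

Definition preimage_supp (Y : set (set K)) (X : set (set L)) (B : divisor K) :
    set (set L) :=
  [set P | X P /\ exists2 Q, supp Y B Q & lies_over Q P].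

(* The spectrum over Y of the sheaf of algebras
     O_Y + O_Y(-M) z + ... + O_Y(-(n-1)M) z^(n-1)
   contained in L: if f is a local equation of M at O, it is given over O by
   adjoining f * z. *)
Definition relative_spec (Y : set (set K)) (M : divisor K) (z : L) : set (set L) :=
  [set P | exists O f, [/\ Y O, local_equation M O f
    & spec_over (subring_gen (phi @` O `|` [set phi f * z]))
                (phi @` nonunits O) P]].

(* B - n M = div h, and X has function field L = K[z]/(z^n - h); if f is a
   local equation of M then b = h f^n is one of B, and X is given locally by
   (f z)^n = b.  The function field of the covering is always of this form,
   because B is nonzero and reduced. *)
Definition cyclic_covering (n : nat) (Y : set (set K)) (B : divisor K)
    (X : set (set L)) : Prop :=
  [/\ smooth_reduced_divisor Y B, supp Y B !=set0
    & exists (M : divisor K) (h : K) (z : L),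
      [/\ cartier_divisor Y M, linear_equivalence_by Y n B M h,
          z ^+ n = phi h,
          forall w : L, exists! a : {ffun 'I_n -> K},
            w = \sum_(i < n) phi (a i) * z ^+ i
        & X = relative_spec Y M z]].

End Morphisms.

Section BlowingUp.
Variable K : fieldType.
Implicit Types (Y : set (set K)) (O p : set K) (B C : divisor K).

(* The points over O of the blowing up of Y at the closed point O are those
   of Proj (\bigoplus_d m^d), whose charts are Spec O[m / x], 0 != x \in m,
   where m is the maximal ideal of O. *)
Definition blowup Y O : set (set K) :=
  (Y `\ O) `|`
  [set p | exists x, [/\ x != 0, nonunits O x
    & spec_over (subring_gen (O `|` [set y / x | y in nonunits O]))
                (nonunits O) p]].

Definition exceptional_curve Y O : set (set K) :=
  [set p | blowup Y O p /\ lies_over idfun O p].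

(* C' is the divisor on the blowing up which agrees with (the pullback of) C
   off the exceptional curve E, and does not contain E. *)
Definition strict_transform Y O C C' : Prop :=
  [/\ effective_divisor (blowup Y O) C',
      forall p, blowup Y O p -> ~ exceptional_curve Y O p ->
        C' p = pullback idfun Y C p
    & ~ exceptional_curve Y O `<=` supp (blowup Y O) C'].

(* Y_i is the blowing up of Y_(i-1) at Q_i; the points are numbered from 1. *)
Fixpoint blowup_tower Y (Q : nat -> set K) (i : nat) : set (set K) :=
  if i is j.+1 then blowup (blowup_tower Y Q j) (Q i) else Y.

Definition strict_transforms (n : nat) Y (Q : nat -> set K) C
    (Ct : nat -> divisor K) : Prop :=
  Ct 0%N = C /\
  forall i, (0 < i < n)%N ->
    strict_transform (blowup_tower Y Q i.-1) (Q i) (Ct i.-1) (Ct i).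

(* (Q_1, ..., Q_n) is the cluster with origin Q_1 determined by B. *)
Definition cluster_of (n : nat) Y B (Q : nat -> set K) : Prop :=
  exists Bt, strict_transforms n Y Q B Bt /\
  forall i, (0 < i < n)%N ->
    exceptional_curve (blowup_tower Y Q i.-1) (Q i)
      `&` supp (blowup_tower Y Q i) (Bt i) = [set Q i.+1].

Definition passes_through (n : nat) Y (Q : nat -> set K) C (m : nat -> nat) : Prop :=
  exists Ct, strict_transforms n Y Q C Ct /\
  forall i, (0 < i <= n)%N -> multiplicity (Ct i.-1) (Q i) (m i).

End BlowingUp.

(* Main.v *)
Require Import Defs.
From mathcomp Require Import all_boot all_order all_algebra.
From mathcomp Require Import boolp classical_sets reals.
From mathcomp Require Import complex.
From mathcomp Require Import ring.

(** Let [O] be the local ring of [Y] at [Q] and [b] a local equation of [B].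
    As [B] is smooth at [Q], there is a [y] such that [b] and [y] generate the
    maximal ideal of [O], and the local ring [P] of the covering, where
    [w ^+ n = b], is regular with parameters [w] and [y]
    ([regular_parameter], [root_extension_regular_pair]).

    The strict transforms of [B] are the curves [b / y ^+ i = 0], so that the
    local ring [O_i] of the cluster point [Q_(i + 1)] is regular with
    parameters [b / y ^+ i] and [y] ([cluster_tower]).  If [C] has local
    equation [f] at [Q], its successive strict transforms have at these points
    the equations [f], [f / y ^+ m_1], [f / y ^+ (m_1 + m_2)], and so on
    ([tower_transformP]).

    The multiplicities are compared in the discrete valuation ring [V] of the
    exceptional curve of the blowing up of [P], in which [y] is a uniformizer.
    The multiplicity of [f] at [P] is [m], hence [f / y ^+ m] is a unit of [V]:
    this is the leading form of [f], dehomogenized, and [w / y] is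
    transcendental over the residue field ([leading_form],
    [except_point_unit]).  On the other hand [V] contains every [O_i] with
    [i < n], and [b / y ^+ n = (w / y) ^+ n] is a transcendental residue too.
    So [V] induces on the last ring [O_(n - 1)] its own adic order, and
    [f / y ^+ (m_1 + ... + m_n)] is a unit of [V] as well ([last_valuation]).
    Therefore [m = m_1 + ... + m_n] ([sum_tower_order]).

    In monomials: [m_1 + ... + m_k] is the order of [f] for which [b] has weight
    [k] and [y] has weight 1, and for [k = n] these are their orders at [P].

    It remains that these strict transforms are effective Cartier divisors on
    the whole surface.  The blowing up is controlled through the conditions
    collected in [blowable], which hold on a projective surface
    ([projective_blowable]) and are inherited by the blowing up
    ([blowup_blowable]). *)

Set Implicit Arguments.
Unset Strict Implicit.
Unset Printing Implicit Defensive.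

Import GRing.Theory.
Local Open Scope classical_set_scope.
Local Open Scope ring_scope.

Local Notation hornerS :=
  (hornerD, hornerN, hornerM, hornerC, hornerX, hornerZ, hornerXn).

(** * Subrings, ideals and local rings inside a field *)

Section Subrings.
Variable K : fieldType.
Implicit Types (A I O S T : set K) (p q : {poly K}).

Lemma subringP A : subring A <->
  [/\ A 1, forall x y, A x -> A y -> A (x - y)
    & forall x y, A x -> A y -> A (x * y)].
Proof.
split=> -[h1 hB hM]; split.
- by move: h1; rewrite inE.
- by move=> x y hx hy; move: (hB x y); rewrite !inE; apply.
- by move=> x y hx hy; move: (hM x y); rewrite !inE; apply.
- by rewrite inE.
- by move=> x y; rewrite !inE; apply: hB.
- by move=> x y; rewrite !inE; apply: hM.
Qed.

Section Closure.
Variables (A : set K) (hA : subring A).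

Lemma subring1 : A 1. Proof. by case/subringP: hA. Qed.

Lemma subringB x y : A x -> A y -> A (x - y).
Proof. by case/subringP: hA => _ h _; apply: h. Qed.

Lemma subringM x y : A x -> A y -> A (x * y).
Proof. by case/subringP: hA => _ _ h; apply: h. Qed.

Lemma subring0 : A 0.
Proof. by rewrite -(subrr 1); apply: subringB; exact: subring1. Qed.

Lemma subringN x : A x -> A (- x).
Proof. by rewrite -sub0r; apply: subringB; exact: subring0. Qed.

Lemma subringD x y : A x -> A y -> A (x + y).
Proof. by move=> hx hy; rewrite -(opprK y); apply/subringB/subringN. Qed.

Lemma subringX x n : A x -> A (x ^+ n).
Proof.
move=> hx; elim: n => [|n IH]; first exact: subring1.
by rewrite exprS; apply: subringM.
Qed.

Lemma subring_sum (J : Type) (r : seq J) (P : pred J) (F : J -> K) :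
  (forall i, P i -> A (F i)) -> A (\sum_(i <- r | P i) F i).
Proof. by move=> h; apply: (big_ind A) => //; [exact: subring0|exact: subringD]. Qed.

End Closure.

Lemma subring_gen_subring S : subring (subring_gen S).
Proof.
apply/subringP; split=> [|x y hx hy|x y hx hy] M [hM sM].
- exact: subring1.
- by apply: (subringB hM); [apply: hx|apply: hy].
- by apply: (subringM hM); [apply: hx|apply: hy].
Qed.

Lemma ideal_gen_ideal A S : subring A -> S `<=` A -> ideal A (ideal_gen A S).
Proof.
move=> hA sSA; split.
- apply: smallest_sub => //; split=> //; first exact: subring0.
    by move=> x y; apply: subringD.
  by move=> a x; apply: subringM.
- by move=> M [[_ ? _ _]].
- by move=> x y hx hy M [hM sM]; case: (hM) => _ _ hD _; apply: hD;
    [apply: hx|apply: hy].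
- by move=> a x ha hx M [hM sM]; case: (hM) => _ _ _; apply=> //; apply: hx.
Qed.

Lemma subset_ideal_gen A S : S `<=` ideal_gen A S.
Proof. exact: sub_gen_smallest. Qed.

Lemma ideal_gen_min A S I : ideal A I -> S `<=` I -> ideal_gen A S `<=` I.
Proof. by move=> *; apply: smallest_sub. Qed.

Lemma ideal_gen_id A I : ideal A I -> ideal_gen A I = I.
Proof. by move=> hI; apply: smallest_id. Qed.

Section IdealClosure.
Variables (A I : set K) (hA : subring A) (hI : ideal A I).

Lemma ideal_sub x : I x -> A x. Proof. by case: hI => h _ _ _; apply: h. Qed.
Lemma ideal0 : I 0. Proof. by case: hI. Qed.
Lemma idealD x y : I x -> I y -> I (x + y).
Proof. by case: hI => _ _ h _; apply: h. Qed.
Lemma ideal_mull a x : A a -> I x -> I (a * x).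
Proof. by case: hI => _ _ _ h; apply: h. Qed.
Lemma ideal_mulr a x : A a -> I x -> I (x * a).
Proof. by rewrite mulrC; apply: ideal_mull. Qed.
Lemma idealN x : I x -> I (- x).
Proof. by rewrite -mulN1r; apply: ideal_mull; apply: (subringN hA (subring1 hA)). Qed.
Lemma idealB x y : I x -> I y -> I (x - y).
Proof. by move=> hx hy; apply: idealD => //; exact: idealN. Qed.
Lemma ideal_sum (J : Type) (r : seq J) (P : pred J) (F : J -> K) :
  (forall i, P i -> I (F i)) -> I (\sum_(i <- r | P i) F i).
Proof. by move=> h; apply: (big_ind I) => //; [exact: ideal0|exact: idealD]. Qed.

End IdealClosure.

Lemma principal_ideal A f : subring A -> A f -> ideal A (principal A f).
Proof.
move=> hA hf; split.
- by move=> _ [a ha <-]; apply: subringM.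
- by exists 0; [exact: subring0|rewrite mulr0].
- by move=> _ _ [a ha <-] [c hc <-]; exists (a + c); [exact: subringD|rewrite mulrDr].
- by move=> a _ ha [c hc <-]; exists (a * c); [exact: subringM|rewrite mulrCA].
Qed.

Lemma principalP A f x : f != 0 -> principal A f x <-> A (x / f).
Proof.
move=> f0; split=> [[a ha <-]|h]; first by rewrite mulrAC divff ?mul1r.
by exists (x / f) => //; rewrite mulrCA divff // mulr1.
Qed.

Lemma principal_unit A f u : subring A -> u != 0 -> A u -> A u^-1 ->
  principal A (f * u) = principal A f.
Proof.
move=> hA u0 hu hv; apply/seteqP; split=> _ [a ha <-].
  by exists (u * a); [exact: subringM|rewrite mulrA].
by exists (u^-1 * a); [exact: subringM|rewrite mulrA mulfK].
Qed.

(** * Units and nonunits *)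

Definition unit_of A x := [/\ x != 0, A x & A x^-1].

Lemma nonunitsP A x : nonunits A x <-> A x /\ (A x^-1 -> x = 0).
Proof.
split=> -[hx h]; split=> //.
  move=> hv; apply/eqP/negPn/negP => x0; apply: h.
  by exists x^-1 => //; rewrite divff.
case=> y hy xy1; have x0 : x != 0.
  by apply/eqP => x0; move: xy1; rewrite x0 mul0r => /eqP; rewrite eq_sym oner_eq0.
move/eqP: x0; apply; apply: h.
by rewrite -(mulr1 x^-1) -xy1 mulKf //; apply/eqP => x0; move: xy1;
  rewrite x0 mul0r => /eqP; rewrite eq_sym oner_eq0.
Qed.

Lemma nonunits_sub A x : nonunits A x -> A x.
Proof. by case. Qed.

Lemma unit_or_nonunit A x : A x -> unit_of A x \/ nonunits A x.
Proof.
move=> hx; have [/nonunitsP|h] := pselect (nonunits A x); first by right; apply/nonunitsP.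
left; split=> //; first by apply/eqP => x0; apply/h/nonunitsP.
by apply: contrapT => hv; apply/h/nonunitsP.
Qed.

Lemma unit_not_nonunit A x : unit_of A x -> ~ nonunits A x.
Proof. by case=> /eqP x0 _ hv /nonunitsP[_ /(_ hv)]. Qed.

Lemma not_nonunit_unit A x : A x -> ~ nonunits A x -> unit_of A x.
Proof. by move=> /unit_or_nonunit[]. Qed.

Lemma unit_of_sub A T x : A `<=` T -> unit_of A x -> unit_of T x.
Proof. by move=> sAT [x0 hx hv]; split=> //; apply: sAT. Qed.

Lemma unit_ofM A x y : subring A -> unit_of A x -> unit_of A y -> unit_of A (x * y).
Proof.
move=> hA [x0 hx hxv] [y0 hy hyv]; split; rewrite ?mulf_neq0 ?invfM //;
by apply: subringM.
Qed.

Lemma unit_of1 A : subring A -> unit_of A 1.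
Proof. by move=> hA; split; rewrite ?oner_eq0 ?invr1 //; apply: subring1. Qed.

Section Local.
Variables (O : set K) (hO : local_ring O).

Lemma local_subring : subring O. Proof. by case: hO. Qed.
Lemma local_ideal : ideal O (nonunits O). Proof. by case: hO. Qed.

Lemma nonunits_neq1 : ~ nonunits O 1.
Proof. exact/unit_not_nonunit/unit_of1/local_subring. Qed.

Lemma unit_ofD x y : unit_of O x -> nonunits O y -> unit_of O (x + y).
Proof.
move=> ux ny; apply: not_nonunit_unit.
  by apply: (subringD local_subring); [case: ux|case: ny].
move=> nxy; apply: (unit_not_nonunit ux); rewrite -(addrK y x).
exact: (idealB local_subring local_ideal).
Qed.

End Local.

Lemma ideal_pow_ideal O d : subring O -> ideal O (ideal_pow O (nonunits O) d).
Proof.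
move=> sO; apply: ideal_gen_ideal => // _ [a ha <-].
by apply: (big_ind O) => [|? ?|i _]; [exact: subring1|exact: subringM|exact: nonunits_sub].
Qed.

Lemma nonunits_prime O : local_ring O -> prime_ideal O (nonunits O).
Proof.
move=> hO; split; [exact: local_ideal|exact: nonunits_neq1|].
move=> x y /unit_or_nonunit[ux|]; last by left.
move=> /unit_or_nonunit[uy|]; last by right.
by move/(unit_not_nonunit (unit_ofM (local_subring hO) ux uy)).
Qed.

(** * Localization *)

Section Localization.
Variables (A I : set K) (hA : subring A) (hI : prime_ideal A I).

Let hid : ideal A I. Proof. by case: hI. Qed.

Lemma prime_neq0 s : ~ I s -> s != 0.
Proof. by move=> hs; apply/eqP => s0; apply: hs; rewrite s0; apply: ideal0 hid. Qed.

Lemma prime_compl s t : A s -> A t -> ~ I s -> ~ I t -> ~ I (s * t).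
Proof. by move=> hs ht ns nt; case: hI => _ _ h /(h _ _ hs ht)[]. Qed.

Lemma prime1 : ~ I 1. Proof. by case: hI. Qed.

Lemma sub_localization : A `<=` localization A I.
Proof.
move=> a ha; exists a, 1; split=> //; rewrite ?divr1 //.
  exact: subring1.
exact: prime1.
Qed.

Lemma localization_subring : subring (localization A I).
Proof.
apply/subringP; split.
- exact: (sub_localization (subring1 hA)).
- move=> _ _ [a [s [ha hs ns ->]]] [c [t [hc ht nt ->]]].
  exists (a * t - c * s), (s * t); split.
  + by apply: (subringB hA); apply: subringM.
  + exact: subringM.
  + exact: prime_compl.
  + by have := prime_neq0 ns; have := prime_neq0 nt; move=> *; field; apply/andP.
- move=> _ _ [a [s [ha hs ns ->]]] [c [t [hc ht nt ->]]].
  exists (a * c), (s * t); split; [exact: subringM|exact: subringM|exact: prime_compl|].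
  by have := prime_neq0 ns; have := prime_neq0 nt; move=> *; field; apply/andP.
Qed.

Lemma localization_unit s : A s -> ~ I s -> unit_of (localization A I) s.
Proof.
move=> hs ns; split; [exact: prime_neq0|exact: sub_localization|].
by exists 1, s; split; rewrite ?mul1r //; apply: subring1.
Qed.

Lemma localization_nonunitsP x : nonunits (localization A I) x <->
  exists a s, [/\ I a, A s, ~ I s & x = a / s].
Proof.
split=> [[[a [s [ha hs ns ->]]] nx]|[a [s [ha hs ns ->]]]].
  exists a, s; split=> //; apply: contrapT => na; apply: nx.
  have a0 := prime_neq0 na; have s0 := prime_neq0 ns.
  exists (s / a); first by exists s, a.
  by field; apply/andP.
apply/nonunitsP; split; first by exists a, s; split=> //; apply: ideal_sub hid _ ha.
case=> c [t [hc ht nt]]; rewrite invf_div => e; apply/eqP/negPn/negP => as0.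
have s0 := prime_neq0 ns; have t0 := prime_neq0 nt.
have a0 : a != 0 by apply: contraNneq as0 => ->; rewrite mul0r.
move/eqP: e; rewrite eqr_div // => /eqP e.
by apply: (prime_compl hs ht ns nt); rewrite e; apply: (ideal_mull hid).
Qed.

Lemma localization_nonunits x : I x -> nonunits (localization A I) x.
Proof.
move=> hx; apply/localization_nonunitsP; exists x, 1.
by split; rewrite ?divr1 //; [apply: subring1|apply: prime1].
Qed.

Lemma localization_local : local_ring (localization A I).
Proof.
split; first exact: localization_subring.
split.
- by move=> x /nonunits_sub.
- exact: (localization_nonunits (ideal0 hid)).
- move=> x y /localization_nonunitsP[a [s [ha hs ns ->]]].
  move=> /localization_nonunitsP[c [t [hc ht nt ->]]].
  apply/localization_nonunitsP; exists (a * t + c * s), (s * t); split.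
  + by apply: (idealD hid); apply: (ideal_mulr hid).
  + exact: subringM.
  + exact: prime_compl.
  + by have := prime_neq0 ns; have := prime_neq0 nt; move=> *; field; apply/andP.
- move=> _ x [c [t [hc ht nt ->]]] /localization_nonunitsP[a [s [ha hs ns ->]]].
  apply/localization_nonunitsP; exists (c * a), (t * s); split.
  + exact: (ideal_mull hid).
  + exact: subringM.
  + exact: prime_compl.
  + by have := prime_neq0 ns; have := prime_neq0 nt; move=> *; field; apply/andP.
Qed.

Lemma localization_min T : subring T -> A `<=` T ->
  (forall s, A s -> ~ I s -> unit_of T s) -> localization A I `<=` T.
Proof.
move=> hT sAT uT _ [a [s [ha hs ns ->]]]; apply: (subringM hT); first exact: sAT.
by case: (uT s hs ns).
Qed.

End Localization.

(** * Polynomials over a subring *)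

Definition poly_over A p := forall i, A p`_i.

Section PolyOver.
Variables (A : set K) (hA : subring A).

Lemma poly_overC a : A a -> poly_over A a%:P.
Proof. by move=> ha i; rewrite coefC; case: eqP => // _; exact: subring0. Qed.

Lemma poly_overX : poly_over A 'X.
Proof. by move=> i; rewrite coefX; case: eqP => // _; [exact: subring1|exact: subring0]. Qed.

Lemma poly_overD p q : poly_over A p -> poly_over A q -> poly_over A (p + q).
Proof. by move=> hp hq i; rewrite coefD; apply: subringD. Qed.

Lemma poly_overB p q : poly_over A p -> poly_over A q -> poly_over A (p - q).
Proof. by move=> hp hq i; rewrite coefB; apply: subringB. Qed.

Lemma poly_overM p q : poly_over A p -> poly_over A q -> poly_over A (p * q).
Proof. by move=> hp hq i; rewrite coefM; apply: subring_sum => // j _; apply: subringM. Qed.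

Lemma poly_overXn p n : poly_over A p -> poly_over A (p ^+ n).
Proof.
move=> hp; elim: n => [|n IH]; first exact: (poly_overC (subring1 hA)).
by rewrite exprS; apply: poly_overM.
Qed.

Lemma horner_over p x : A x -> poly_over A p -> A p.[x].
Proof.
move=> hx hp; rewrite horner_coef; apply: subring_sum => // i _.
by apply: subringM => //; apply: subringX.
Qed.

Lemma adjoinE x : subring_gen (A `|` [set x]) = [set p.[x] | p in poly_over A].
Proof.
apply/seteqP; split.
  apply: smallest_sub => [|y [hy|->]]; last 2 first.
  - by exists y%:P; [exact: poly_overC|rewrite hornerC].
  - by exists 'X; [exact: poly_overX|rewrite hornerX].
  apply/subringP; split.
  - by exists 1%:P; [exact: (poly_overC (subring1 hA))|rewrite hornerC].
  - by move=> _ _ [p hp <-] [q hq <-]; exists (p - q); [exact: poly_overB|rewrite !hornerE].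
  - by move=> _ _ [p hp <-] [q hq <-]; exists (p * q); [exact: poly_overM|rewrite !hornerE].
have hB := subring_gen_subring (A `|` [set x]).
move=> _ [p hp <-]; rewrite horner_coef; apply: (subring_sum hB) => i _.
apply: (subringM hB); first by apply: sub_gen_smallest; left; apply: hp.
by apply: (subringX hB); apply: sub_gen_smallest; right.
Qed.

End PolyOver.

Lemma poly_over_sub A T p : A `<=` T -> poly_over A p -> poly_over T p.
Proof. by move=> sAT hp i; apply: sAT. Qed.

End Subrings.

(** * Finitely generated ideals and Nakayama's lemma *)

Section FinitelyGenerated.
Variable K : fieldType.
Implicit Types (A I S : set K) (s : seq K).

Lemma ideal_gen_nil A : subring A -> ideal_gen A [set` [::]] `<=` [set 0].
Proof.
move=> hA; apply: ideal_gen_min => //; split=> //.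
- by move=> _ ->; exact: subring0.
- by move=> _ _ -> ->; rewrite addr0.
- by move=> a _ _ ->; rewrite mulr0.
Qed.

Lemma ideal_gen_cons A x s t : subring A -> [set` x :: s] `<=` A ->
  ideal_gen A [set` x :: s] t ->
  exists a r, [/\ A a, ideal_gen A [set` s] r & t = a * x + r].
Proof.
move=> hA sA; have ss : [set` s] `<=` A.
  by move=> y hy; apply: sA; rewrite /= inE; apply/orP; right.
have hx : A x by apply: sA; rewrite /= mem_head.
have hJ := ideal_gen_ideal hA ss.
have hI : ideal A [set t | exists a r, [/\ A a, ideal_gen A [set` s] r & t = a * x + r]].
  split.
  - move=> _ [a [r [ha hr ->]]]; apply: (subringD hA); first exact: subringM.
    exact: (ideal_sub hJ).
  - by exists 0, 0; split; [exact: subring0|exact: (ideal0 hJ)|rewrite mul0r addr0].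
  - move=> _ _ [a [r [ha hr ->]]] [a' [r' [ha' hr' ->]]].
    exists (a + a'), (r + r'); split; [exact: subringD|exact: (idealD hJ)|by ring].
  - move=> c _ hc [a [r [ha hr ->]]]; exists (c * a), (c * r).
    by split; [exact: subringM|exact: (ideal_mull hJ)|ring].
apply: (ideal_gen_min hI) => y; rewrite /= inE => /orP[/eqP->|hy].
  by exists 1, 0; split; [exact: subring1|exact: (ideal0 hJ)|ring].
exists 0, y; split; [exact: subring0| |by ring].
exact: subset_ideal_gen.
Qed.

End FinitelyGenerated.

Section Nakayama.
Variables (K : fieldType) (O : set K).
Hypotheses (hO : local_ring O) (nO : noetherian O).

Let sO := local_subring hO.

(** Nakayama's lemma, for the ideal generated by [S] in the quotient by [I]:
    the condition on [S] says that this ideal is multiplied onto itself by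
    the nonunit [c]. *)
Lemma nakayama (I S : set K) c : ideal O I -> nonunits O c -> S `<=` O ->
  (forall t, S t -> exists2 t', S t' & I (t - c * t')) -> S `<=` I.
Proof.
move=> hI nc SO hS; have hJ := ideal_gen_ideal sO SO.
have cO := nonunits_sub nc; have [s sJ] := nO hJ.
have JcJ : ideal_gen O S `<=` [set t | exists2 t', ideal_gen O S t' & I (t - c * t')].
  apply: ideal_gen_min => [|t /hS[t' ht' h]]; last first.
    by exists t' => //; apply: subset_ideal_gen.
  have JO t : [set t | exists2 t', ideal_gen O S t' & I (t - c * t')] t -> O t.
    case=> t' /(ideal_sub hJ) ht' /(ideal_sub hI) h; rewrite -(subrK (c * t') t).
    by apply: (subringD sO) => //; apply: (subringM sO).
  split=> //; first by exists 0; [exact: (ideal0 hJ)|rewrite mulr0 subr0; exact: (ideal0 hI)].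
  - move=> t u [t' ht' h] [u' hu' k]; exists (t' + u'); first exact: (idealD hJ).
    by rewrite (_ : _ - _ = (t - c * t') + (u - c * u')); [exact: (idealD hI)|ring].
  - move=> a t ha [t' ht' h]; exists (a * t'); first exact: (ideal_mull hJ).
    by rewrite (_ : _ - _ = a * (t - c * t')); [exact: (ideal_mull hI)|ring].
suff main (s' : seq K) : [set` s'] `<=` ideal_gen O S ->
    (forall t, ideal_gen O S t -> exists2 r, ideal_gen O [set` s'] r & I (t - r)) ->
    ideal_gen O S `<=` I.
  apply: subset_trans (@subset_ideal_gen _ O S) _; apply: (main s).
    by move=> x hx; rewrite sJ; apply: subset_ideal_gen.
  by move=> t ht; exists t; [rewrite -sJ|rewrite subrr; exact: (ideal0 hI)].
elim: s' => [_ h t /h[r /(ideal_gen_nil sO) -> ]|x s' IH xsJ h]; first by rewrite subr0.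
have s'J : [set` s'] `<=` ideal_gen O S.
  by move=> y hy; apply: xsJ; rewrite /= inE; apply/orP; right.
have hx : ideal_gen O S x by apply: xsJ; rewrite /= mem_head.
have JO := ideal_sub hJ; have hs' := ideal_gen_ideal sO (subset_trans s'J JO).
apply: (IH s'J).
have redx u : ideal_gen O S u -> exists a r,
    [/\ O a, ideal_gen O [set` s'] r & I (u - (c * a * x + r))].
  case/JcJ => u' /h[w /(ideal_gen_cons sO (subset_trans xsJ JO))[a [r [ha hr ->]]] iu] iv.
  exists a, (c * r); split=> //; first exact: (ideal_mull hs').
  rewrite (_ : _ - _ = (u - c * u') + c * (u' - (a * x + r))); last by ring.
  by apply: (idealD hI) => //; apply: (ideal_mull hI).
(* The generator x is congruent to a multiple of itself by the nonunit c * a,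
   up to the other generators, and 1 - c * a is invertible. *)
have [a [r [ha hr ir]]] := redx x hx.
have [u0 hu hv] : unit_of O (1 - c * a).
  apply: (unit_ofD hO (unit_of1 sO)); apply: (idealN sO (local_ideal hO)).
  exact: (ideal_mulr (local_ideal hO) ha nc).
move=> t /redx[a' [r' [ha' hr' ir']]].
have hk : O (c * a' / (1 - c * a)) by apply: (subringM sO) => //; apply: (subringM sO).
exists (c * a' / (1 - c * a) * r + r').
  by apply: (idealD hs') => //; apply: (ideal_mull hs').
rewrite (_ : t - _ = (t - (c * a' * x + r'))
   + c * a' / (1 - c * a) * (x - (c * a * x + r))); last by field.
by apply: (idealD hI) => //; apply: (ideal_mull hI).
Qed.

End Nakayama.

(** * Systems of parameters in dimension two *)

(** A system of parameters [b, y], encoded by what is needed to compute with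
    the associated blowing up: the two elements generate the maximal ideal
    and form a regular sequence.  Divisibility of [a] by [b] is [O (a / b)]. *)
Record regular_pair (K : fieldType) (O : set K) (b y : K) : Prop := RegularPair {
  rp_local : local_ring O;
  rp_neq0 : b != 0;
  rp_gen : forall x, nonunits O x <-> exists u v, [/\ O u, O v & x = u * b + v * y];
  rp_reg : forall a, O a -> O (a * y / b) -> O (a / b) }.

Section DimensionTwo.
Variables (K : fieldType) (O : set K) (b y : K).
Hypotheses (hO : local_ring O) (nO : noetherian O) (b0 : b != 0).
Hypothesis gen : forall x,
  nonunits O x <-> exists u v, [/\ O u, O v & x = u * b + v * y].

Let sO := local_subring hO.
Let mO := local_ideal hO.

Let nb : nonunits O b.
Proof.
by apply/gen; exists 1, 0; split; [exact: subring1|exact: subring0|ring].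
Qed.

Let ny : nonunits O y.
Proof.
by apply/gen; exists 0, 1; split; [exact: subring0|exact: subring1|ring].
Qed.

Let Ob := nonunits_sub nb.
Let Oy := nonunits_sub ny.

Let ideal_b : ideal O (principal O b) := principal_ideal sO Ob.

(** Modulo [b] the maximal ideal is generated by [y], so an element that is
    never a unit times a power of [y] can be divided by [y] indefinitely
    without leaving the set of such elements, and Nakayama's lemma puts it in
    the ideal of [b]. *)
Lemma unit_times_power a : O a ->
  O (a / b) \/ exists j u, unit_of O u /\ O ((a - y ^+ j * u) / b).
Proof.
pose S := [set a | O a /\ ~ exists j u, unit_of O u /\ O ((a - y ^+ j * u) / b)].
move=> ha; have [h|h] := pselect (S a); last first.
  by right; apply: contrapT => h'; apply: h.
left; apply/(principalP _ _ b0)/(nakayama hO nO ideal_b ny (S := S)) => // [t []//|].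
move=> t [ht nt].
case: (unit_or_nonunit ht) => [ut|/gen[u [v [hu hv e]]]]; last first.
  exists v; last by exists u; rewrite // e; ring.
  split=> // -[j [w [uw hw]]]; apply: nt; exists j.+1, w; split=> //.
  rewrite (_ : _ / b = u + y * ((v - y ^+ j * w) / b)); last by rewrite e exprS; field.
  by apply: (subringD sO) => //; apply: (subringM sO).
case: nt; exists 0%N, t; split=> //.
by rewrite expr0 mul1r subrr mul0r; exact: subring0.
Qed.

(** Were [y] nilpotent modulo [b], a prime strictly between 0 and the maximal
    ideal would be generated by some [pi] that is a power of [y] modulo [b];
    then a power of [pi] would be divisible by [b], which is impossible as
    [pi] is prime and does not divide [b]. *)
Lemma power_not_multiple : krull_dim O 2 -> forall k, ~ O (y ^+ k / b).
Proof.
case=> -[p [hp pS]] _ k hk.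
have [p0 p1 p2] := And3 (hp 0%N isT) (hp 1%N isT) (hp 2%N isT).
have [I1 n1 m1] := p1; have [I2 n2 _] := p2.
have p2m : p 2%N `<=` nonunits O.
  move=> x hx; have /unit_or_nonunit[[x0 _ hv]|//] := ideal_sub I2 hx.
  by case: n2; rewrite -(mulVf x0); apply: (ideal_mull I2).
have nbp : ~ p 1%N b.
  move=> hb; have hy : p 1%N y.
    have : p 1%N (y ^+ k).
      by rewrite -(divfK b0 (y ^+ k)); apply: (ideal_mull I1).
    elim: (k) => [//|j IH]; rewrite exprS => /m1[]//; exact: (subringX sO).
  have [_] := pS 1%N isT; apply=> x /p2m/gen[u [v [hu hv ->]]].
  by apply: (idealD I1); apply: (ideal_mull I1).
have divb t : O (t / b) -> p 1%N t -> p 1%N (t / b).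
  by move=> ht; rewrite -{1}(divfK b0 t) mulrC => /(m1 _ _ Ob ht)[].
have p1m x : p 1%N x -> nonunits O x.
  by move=> hx; apply: p2m; case: (pS 1%N isT) => + _; apply.
have [pi [hpi npi]] : exists t, p 1%N t /\ ~ O (t / b).
  have [_ h] := pS 0%N isT; apply: contrapT => nex; apply: h.
  suff h0 : p 1%N `<=` principal O 0.
    by move=> t /h0[a _ <-]; rewrite mul0r; case: p0 => I0 _ _; exact: (ideal0 I0).
  apply: (nakayama hO nO _ nb) => [|t /(ideal_sub I1)//|t ht].
    exact: (principal_ideal sO (subring0 sO)).
  have hb : O (t / b) by apply: contrapT => ?; apply: nex; exists t.
  by exists (t / b); [exact: divb|exists 0; [exact: subring0|field]].
pose P j := exists2 t, p 1%N t & O ((t - y ^+ j) / b).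
have leading t j u : p 1%N t -> unit_of O u -> O ((t - y ^+ j * u) / b) -> P j.
  move=> ht [u0 hu hv] h; exists (t * u^-1); first exact: (ideal_mulr I1).
  by rewrite (_ : _ / b = (t - y ^+ j * u) / b * u^-1); [exact: subringM|field; apply/andP].
have exP : exists j, `[< P j >].
  have [//|[j [u [uu hu]]]] := unit_times_power (ideal_sub I1 hpi).
  by exists j; apply/asboolP; exact: leading hu.
case: (ex_minnP exP) => j /asboolP[{hpi npi}pi hpi hpj] jmin.
have p1pi : p 1%N `<=` principal O pi.
  have Opi := ideal_sub I1 hpi.
  apply: (nakayama hO nO (principal_ideal sO Opi) nb) => [t /(ideal_sub I1)//|t ht].
  have [ht'|[i [u [uu hu]]]] := unit_times_power (ideal_sub I1 ht).
    by exists (t / b); [exact: divb|exists 0; [exact: subring0|field]].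
  have ji : (j <= i)%N by apply: jmin; apply/asboolP; exact: leading hu.
  have Ow : O (y ^+ (i - j) * u).
    by case: uu => _ ? _; apply: (subringM sO) => //; exact: (subringX sO).
  exists ((t - pi * (y ^+ (i - j) * u)) / b); last first.
    by exists (y ^+ (i - j) * u) => //; field.
  apply: divb; last by apply: (idealB sO I1) => //; exact: (ideal_mulr I1).
  rewrite (_ : _ / b = (t - y ^+ i * u) / b - y ^+ (i - j) * u * ((pi - y ^+ j) / b)).
    by apply: (subringB sO) => //; exact: (subringM sO).
  by rewrite -{2}(subnK ji) exprD; field.
have j0 : (0 < j)%N.
  rewrite lt0n; apply/eqP => j0; move: hpj; rewrite j0 expr0 => h.
  have := unit_ofD hO (unit_of1 sO) (ideal_mulr mO h nb).
  by rewrite mulrC divfK // addrC subrK => /unit_not_nonunit; apply; exact: p1m.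
have Opi := ideal_sub I1 hpi.
have hpik i : O ((pi ^+ i - y ^+ j ^+ i) / b).
  elim: i => [|i IH]; first by rewrite !expr0 subrr mul0r; exact: subring0.
  rewrite (_ : _ / b = pi * ((pi ^+ i - y ^+ j ^+ i) / b)
    + (pi - y ^+ j) / b * y ^+ j ^+ i); last by rewrite !exprS; field.
  by apply: (subringD sO); apply: (subringM sO) => //; do 2!apply: (subringX sO).
have {hpik} : O (pi ^+ k / b).
  rewrite -(subrK (y ^+ j ^+ k) (pi ^+ k)) mulrDl; apply: (subringD sO) => //.
  rewrite -exprM -(prednK j0) mulSn exprD mulrAC.
  by apply: (subringM sO) => //; apply: (subringX sO).
have pi0 : pi != 0.
  apply/eqP => e; have [_ h] := pS 0%N isT; apply: h => t /p1pi[a _ <-].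
  by rewrite e mul0r; case: p0 => I0 _ _; exact: (ideal0 I0).
elim: (k) => [|i IH].
  rewrite expr0 div1r => hv; case: (unit_not_nonunit _ nb).
  by split.
rewrite exprS => h; have : p 1%N (pi * pi ^+ i / b).
  by apply: divb => //; apply: (ideal_mulr I1) => //; exact: subringX.
by move=> /p1pi[a ha e]; apply: IH; rewrite -(mulKf pi0 (pi ^+ i / b)) mulrA -e mulKf.
Qed.

(** Two elements that are not multiples of [b] are units times powers of [y]
    modulo [b], and so is their product. *)
Lemma parameter_prime : krull_dim O 2 -> forall a c, O a -> O c ->
  O (a * c / b) -> O (a / b) \/ O (c / b).
Proof.
move=> d2 a c ha hc hac.
have [|[i [u [uu hu]]]] := unit_times_power ha; first by left.
have [|[j [v [uv hv]]]] := unit_times_power hc; first by right.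
case: (power_not_multiple d2 (k := (i + j)%N)).
have [[u0 _ Ov] [v0 _ Ov']] := (uu, uv).
have Ouy : O (y ^+ i * u) by case: uu => _ ? _; apply: (subringM sO) => //; exact: subringX.
rewrite (_ : _ / b = (a * c / b - c * ((a - y ^+ i * u) / b)
   - y ^+ i * u * ((c - y ^+ j * v) / b)) * u^-1 * v^-1); last first.
  by rewrite exprD; field; apply/and3P.
by do 2!apply: (subringM sO) => //; do 2?apply: (subringB sO) => //; apply: (subringM sO).
Qed.

Lemma parameters_regular_pair : krull_dim O 2 -> regular_pair O b y.
Proof.
move=> d2; split=> // a ha /(parameter_prime d2 ha Oy)[//|h].
by case: (power_not_multiple d2 (k := 1%N)).
Qed.

End DimensionTwo.

(** An element outside the square of the maximal ideal has an invertible
    coefficient on one of the two generators, so that it can replace it. *)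
Lemma regular_parameter (K : fieldType) (O : set K) b :
  regular_local_ring O 2 -> nonunits O b -> ~ ideal_pow O (nonunits O) 2 b ->
  exists2 y, regular_pair O b y &
    forall a c, O a -> O c -> O (a * c / b) -> O (a / b) \/ O (c / b).
Proof.
case=> hO nO d2 [x hx] nb nb2; have sO := local_subring hO.
have mO := local_ideal hO.
have xm i : nonunits O (x i) by rewrite hx; apply: subset_ideal_gen; exists i.
pose i1 : 'I_2 := lift ord0 ord0.
have gx t : nonunits O t <-> exists u v, [/\ O u, O v & t = u * x ord0 + v * x i1].
  split=> [|[u [v [hu hv ->]]]]; last first.
    by apply: (idealD mO); apply: (ideal_mull mO).
  rewrite hx; move: t; apply: ideal_gen_min => [|_ [i _ <-]].
    split.
    - move=> _ [u [v [hu hv ->]]].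
      by apply: (subringD sO); apply: (subringM sO) => //; exact: nonunits_sub.
    - by exists 0, 0; split; [exact: subring0|exact: subring0|ring].
    - move=> _ _ [u [v [hu hv ->]]] [u' [v' [hu' hv' ->]]].
      by exists (u + u'), (v + v'); split; [exact: subringD|exact: subringD|ring].
    - move=> a _ ha [u [v [hu hv ->]]].
      by exists (a * u), (a * v); split; [exact: subringM|exact: subringM|ring].
  have [->|->] : i = ord0 \/ i = i1.
    by case: i => -[|[|//]] ?; [left|right]; apply: val_inj.
  - by exists 1, 0; split; [exact: subring1|exact: subring0|ring].
  - by exists 0, 1; split; [exact: subring0|exact: subring1|ring].
have hpow := ideal_pow_ideal 2 sO.
have b0 : b != 0 by apply/eqP => b0; apply: nb2; rewrite b0; exact: (ideal0 hpow).
have mul2 s t : nonunits O s -> nonunits O t -> ideal_pow O (nonunits O) 2 (s * t).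
  move=> hs ht; apply: subset_ideal_gen; exists (fun i => if i == ord0 then s else t).
    by move=> i /=; case: ifP.
  by rewrite big_ord_recl big_ord1.
have main y z u v : unit_of O u -> O v -> b = u * z + v * y ->
    nonunits O y ->
    (forall t, nonunits O t <-> exists u v, [/\ O u, O v & t = u * z + v * y]) ->
    exists2 y, regular_pair O b y &
      forall a c, O a -> O c -> O (a * c / b) -> O (a / b) \/ O (c / b).
  move=> [u0 hu hu'] hv e ny gz.
  have gb t : nonunits O t <-> exists u v, [/\ O u, O v & t = u * b + v * y].
    split=> [/gz[u1 [v1 [hu1 hv1 ->]]]|[u1 [v1 [hu1 hv1 ->]]]]; last first.
      by apply: (idealD mO); apply: (ideal_mull mO).
    exists (u1 / u), (v1 - u1 / u * v); split; last by rewrite e; field.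
      exact: subringM.
    by apply: (subringB sO) => //; do 2!apply: (subringM sO) => //.
  exists y; first exact: (parameters_regular_pair hO nO b0 gb d2).
  exact: (parameter_prime hO nO b0 gb d2).
have [u [v [hu hv e]]] := iffLR (gx b) nb.
have [uu|nu] := unit_or_nonunit hu; first exact: (main (x i1) (x ord0) u v uu hv e).
have [uv|nv] := unit_or_nonunit hv.
  apply: (main (x ord0) (x i1) v u uv hu); rewrite 1?addrC // => t.
  split=> [/gx[a [c [ha hc ->]]]|[a [c [ha hc ->]]]]; first by exists c, a; rewrite addrC.
  by apply/gx; exists c, a; rewrite addrC.
by case: nb2; rewrite e; apply: (idealD hpow); apply: mul2.
Qed.

(** * Quasi-regularity of a system of parameters *)

(** The affine chart of the blowing up of [O] in which [x] is a local equation
    of the exceptional curve. *)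
Definition chart (K : fieldType) (O : set K) (x : K) : set K :=
  subring_gen (O `|` [set y / x | y in nonunits O]).

(** In the chart of [y], with coordinate [b / y], the ideal of the exceptional
    curve, and that of its intersection with the strict transform of [b = 0]. *)
Definition except_prime (K : fieldType) (O : set K) (b y : K) : set K :=
  [set p.[b / y] | p in poly_over (nonunits O)].

Definition origin_prime (K : fieldType) (O : set K) (b y : K) : set K :=
  [set p.[b / y] | p in [set p | poly_over O p /\ nonunits O p`_0]].

Definition except_point (K : fieldType) (O : set K) (b y : K) : set K :=
  localization (chart O y) (except_prime O b y).

Definition origin_point (K : fieldType) (O : set K) (b y : K) : set K :=
  localization (chart O y) (origin_prime O b y).

Lemma poly_constant_part (K : fieldType) (p : {poly K}) :
  exists q, p = q * 'X + (p`_0)%:P /\ forall i, q`_i = p`_i.+1.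
Proof.
elim/poly_ind: p => [|p c _]; first by exists 0; rewrite mul0r coef0 addr0; split=> // i; rewrite !coef0.
exists p; rewrite coefD coefMX coefC eqxx add0r; split=> // i.
by rewrite coefD coefMX coefC addr0.
Qed.

(** Gauss's lemma: the reduction of polynomials modulo the maximal ideal takes
    values in a polynomial ring over a field, which is an integral domain. *)
Lemma local_gauss (K : fieldType) (O : set K) (p q : {poly K}) :
  local_ring O -> poly_over O p -> poly_over O q ->
  poly_over (nonunits O) (p * q) ->
  poly_over (nonunits O) p \/ poly_over (nonunits O) q.
Proof.
move=> hO hp hq hpq; have mO := local_ideal hO; have sO := local_subring hO.
apply: contrapT => /not_orP[np nq].
have first_unit (r : {poly K}) : ~ poly_over (nonunits O) r ->
    exists i, ~ nonunits O r`_i /\ forall j, (j < i)%N -> nonunits O r`_j.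
  move=> nr; have ex : exists i, `[< ~ nonunits O r`_i >].
    by apply: contrapT => h; apply: nr => i; apply: contrapT => ni; apply: h; exists i; apply/asboolP.
  case: (ex_minnP ex) => i /asboolP hi imin; exists i; split=> // j ji.
  by apply: contrapT => nj; move: ji; rewrite ltnNge imin //; apply/asboolP.
have [i [pi hi]] := first_unit _ np; have [j [qj hj]] := first_unit _ nq.
have [_ _ prm] := nonunits_prime hO.
suff /(prm _ _ (hp i) (hq j))[] : nonunits O (p`_i * q`_j) by [].
have ij : (i < (i + j).+1)%N by rewrite ltnS leq_addr.
have := hpq (i + j)%N; rewrite coefM (bigD1 (Ordinal ij)) //= addKn => h.
rewrite -[_ * _](addrK (\sum_(k < (i + j).+1 | k != Ordinal ij) p`_k * q`_(i + j - k))).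
apply: (idealB sO mO) => //; apply: (ideal_sum mO) => k nk.
have [ki|ki|ki] := ltngtP k i.
- by apply: (ideal_mulr mO) => //; exact: hi.
- apply: (ideal_mull mO) => //; apply: hj.
  by rewrite ltn_subLR ?ltn_add2r // -ltnS.
- by move: nk; rewrite (_ : k = Ordinal ij) ?eqxx //; exact: val_inj.
Qed.

Section RegularPair.
Variables (K : fieldType) (O : set K) (b y : K).
Hypothesis rp : regular_pair O b y.
Implicit Types (p q : {poly K}).

Let hO := rp_local rp.
Let sO := local_subring hO.
Let mO := local_ideal hO.
Let b0 := rp_neq0 rp.

Lemma rp_nonunit1 : nonunits O b.
Proof. by apply/(rp_gen rp); exists 1, 0; split; [exact: subring1|exact: subring0|ring]. Qed.

Lemma rp_nonunit2 : nonunits O y.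
Proof. by apply/(rp_gen rp); exists 0, 1; split; [exact: subring0|exact: subring1|ring]. Qed.

Let Ob := nonunits_sub rp_nonunit1.
Let Oy := nonunits_sub rp_nonunit2.

Lemma rp_neq0' : y != 0.
Proof.
apply/eqP => y0; apply: (unit_not_nonunit _ rp_nonunit1); split=> //.
rewrite -div1r; apply: (rp_reg rp); first exact: subring1.
by rewrite y0 mulr0 mul0r; exact: subring0.
Qed.

Let y0 := rp_neq0'.

Lemma regular_power a k : O a -> O (a * y ^+ k / b) -> O (a / b).
Proof.
move=> ha; elim: k => [|k IH]; rewrite ?expr0 ?mulr1 // exprSr mulrA => h.
by apply/IH/(rp_reg rp) => //; apply: (subringM sO) => //; apply: subringX.
Qed.

Lemma clear_denominators p : poly_over O p -> O (y ^+ size p * p.[b / y]).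
Proof.
move=> hp; rewrite horner_coef mulr_sumr; apply: (subring_sum sO) => i _.
rewrite (_ : y ^+ _ * _ = p`_i * b ^+ i * y ^+ (size p - i)).
  by apply: (subringM sO); [apply: (subringM sO) => //|]; apply: subringX.
by rewrite -{1}(subnK (ltnW (ltn_ord i))) exprD expr_div_n; field; exact: expf_neq0.
Qed.

(** Clearing the denominators of [q] leaves a power of [y] as a factor of [a],
    which regularity allows to remove. *)
Lemma multiple_of_coordinate a q : O a -> poly_over O q ->
  a = b / y * q.[b / y] -> O (a / b).
Proof.
move=> ha hq e; apply: (regular_power (k := (size q).+1)) => //.
rewrite (_ : _ / b = y ^+ size q * q.[b / y]); first exact: clear_denominators.
by rewrite exprSr e; field; apply/andP.
Qed.

(** This makes [b / y] transcendental over the residue field along the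
    exceptional curve.  Regularity of the sequence [b, y] forces the constant
    coefficient to be a multiple of [b], which is absorbed in the next one by
    factoring out [b / y]. *)
Lemma quasi_regular p : poly_over O p -> p.[b / y] = 0 -> poly_over (nonunits O) p.
Proof.
move: {2}(size p) (leqnn (size p)) => n.
elim: n p => [|n IH] p.
  by rewrite leqn0 size_poly_eq0 => /eqP -> _ _ i; rewrite coef0; exact: (ideal0 mO).
move=> sp hp; have [q [ep eq]] := poly_constant_part p; set c := p`_0 in ep *.
have hq : poly_over O q by move=> i; rewrite eq; apply: hp.
rewrite ep hornerMXaddC => e.
have hc : O (c / b).
  apply: (multiple_of_coordinate (q := - q)); first exact: hp.
    by move=> i; rewrite coefN; apply: (subringN sO).
  by rewrite hornerN mulrN mulrC; apply/eqP; rewrite -addr_eq0 addrC e.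
have hyc : O (y * (c / b)) by exact: subringM.
have sq : (size (q + (y * (c / b))%:P)%R <= n)%N.
  have {}sq : (size q <= n)%N by apply/leq_sizeP => j hj; rewrite eq; move/leq_sizeP: sp; apply.
  apply: leq_trans (size_polyD _ _) _; rewrite geq_max sq size_polyC.
  case: n {IH} sp sq => [|n] sp sq; last by case: eqP.
  move: e; move: sq; rewrite leqn0 size_poly_eq0 => /eqP ->.
  by rewrite horner0 mul0r add0r => ->; rewrite mul0r mulr0 eqxx.
have h := IH _ sq (poly_overD sO hq (poly_overC sO hyc)).
have {}h : poly_over (nonunits O) (q + (y * (c / b))%:P).
  apply: h; rewrite !hornerS; apply: (mulIf (mulf_neq0 b0 (invr_neq0 y0))).
  by rewrite mul0r -[RHS]e; field; apply/andP.
move=> [|i]; last first.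
  rewrite coefD coefMX coefC addr0 /= -[q`_i](addrK ((y * (c / b))%:P`_i)) -coefD.
  apply: (idealB sO mO) => //; rewrite coefC; case: eqP => _; last exact: (ideal0 mO).
  exact: (ideal_mulr mO _ rp_nonunit2).
rewrite coefD coefMX coefC add0r /= -(divfK b0 c).
exact: (ideal_mull mO _ rp_nonunit1).
Qed.

(** * Powers of the maximal ideal *)

Lemma form_in_power d p : poly_over O p -> (size p <= d.+1)%N ->
  ideal_pow O (nonunits O) d (y ^+ d * p.[b / y]).
Proof.
move=> hp sp; rewrite horner_coef mulr_sumr.
apply: (ideal_sum (ideal_pow_ideal d sO)) => i _.
have id : (i <= d)%N by rewrite -ltnS (leq_trans (ltn_ord i)).
rewrite (_ : y ^+ _ * _ = p`_i * (b ^+ i * y ^+ (d - i))); last first.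
  by rewrite -{1}(subnK id) exprD expr_div_n; field; exact: expf_neq0.
apply: (ideal_mull (ideal_pow_ideal d sO)) => //; apply: subset_ideal_gen.
exists (fun k : 'I_d => if (k < i)%N then b else y).
  by move=> k /=; case: ifP => _; [exact: rp_nonunit1|exact: rp_nonunit2].
rewrite -(big_mkord xpredT (fun k => if (k < i)%N then b else y)).
rewrite (big_cat_nat (n := i)) //=; congr (_ * _).
  rewrite (eq_big_nat _ _ (F2 := fun=> b)) => [|k /andP[_ ->]//].
  by rewrite prodr_const_nat subn0.
rewrite (eq_big_nat _ _ (F2 := fun=> y)) => [|k /andP[ik _]]; last by rewrite ltnNge ik.
by rewrite prodr_const_nat.
Qed.

(** Forms of degree [d] in [b] and [y] are handled in the dehomogenized shape
    that they take in the chart of the blowing up with coordinate [b / y]. *)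
Lemma ideal_powP d w : ideal_pow O (nonunits O) d w <->
  exists p, [/\ poly_over O p, (size p <= d.+1)%N & w = y ^+ d * p.[b / y]].
Proof.
split=> [|[p [hp sp ->]]]; last exact: form_in_power.
move: w; apply: ideal_gen_min => [|_ [a ha <-]].
  split.
  - move=> _ [p [hp sp ->]].
    by apply: (ideal_sub (ideal_pow_ideal d sO)); apply: form_in_power.
  - exists 0; split; first by move=> i; rewrite coef0; exact: subring0.
      by rewrite size_poly0.
    by rewrite horner0 mulr0.
  - move=> _ _ [p [hp sp ->]] [q [hq sq ->]]; exists (p + q).
    split; first exact: poly_overD; last by rewrite hornerD mulrDr.
    by apply: leq_trans (size_polyD _ _) _; rewrite geq_max sp.
  - move=> a _ Oa [p [hp sp ->]]; exists (a *: p).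
    split; last by rewrite hornerZ mulrCA.
      by move=> i; rewrite coefZ; exact: subringM.
    exact: leq_trans (size_scale_leq _ _) sp.
elim: d a ha => [|d IH] a ha.
  exists 1; split; first exact: (poly_overC sO (subring1 sO)).
    by rewrite size_poly1.
  by rewrite big_ord0 hornerC expr0 mulr1.
rewrite big_ord_recl; have [|p [hp sp ->]] := IH (fun i => a (lift ord0 i)).
  by move=> i; apply: ha.
have [u [v [hu hv ->]]] := iffLR (rp_gen rp (a ord0)) (ha ord0).
exists (p * (u%:P * 'X + v%:P)); split.
- apply: (poly_overM sO) => //; apply: (poly_overD sO); last exact: poly_overC.
  by apply: (poly_overM sO); [exact: poly_overC|exact: (poly_overX sO)].
- apply: leq_trans (size_polyMleq _ _) _.
  have : (size (u%:P * 'X + v%:P)%R <= 2)%N by rewrite size_MXaddC; case: ifP => // _; rewrite size_polyC; case: eqP.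
  move=> h; have := leq_add sp h; rewrite addn2 => h'.
  by rewrite -subn1 leq_subLR add1n.
- by rewrite !hornerS exprS; field.
Qed.

(** If all the coefficients of a form representing [f] were in the maximal
    ideal, then [f] would be in the next power of that ideal. *)
Lemma leading_form d f : ideal_pow O (nonunits O) d f ->
  ~ ideal_pow O (nonunits O) d.+1 f ->
  exists p, [/\ poly_over O p, (size p <= d.+1)%N, f = y ^+ d * p.[b / y]
              & ~ poly_over (nonunits O) p].
Proof.
move=> /ideal_powP[p [hp sp ->]] nf; exists p; split=> // np; apply: nf.
rewrite horner_coef mulr_sumr; apply: (ideal_sum (ideal_pow_ideal _ sO)) => i _.
have [u [v [hu hv e]]] := iffLR (rp_gen rp p`_i) (np i).
have ->: y ^+ d * (p`_i * (b / y) ^+ i)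
    = y ^+ d.+1 * ((u%:P * 'X + v%:P) * 'X^i).[b / y].
  by rewrite e !hornerS exprS; field.
apply: form_in_power.
  apply: (poly_overM sO); last by apply: poly_overXn => //; exact: (poly_overX sO).
  apply: (poly_overD sO); last exact: poly_overC.
  by apply: (poly_overM sO); [exact: poly_overC|exact: (poly_overX sO)].
apply: leq_trans (size_polyMleq _ _) _; rewrite size_polyXn addnS /=.
have : (size (u%:P * 'X + v%:P)%R <= 2)%N by rewrite size_MXaddC; case: ifP => // _; rewrite size_polyC; case: eqP.
move=> h; have id : (i <= d)%N by rewrite -ltnS (leq_trans (ltn_ord i)).
by have := leq_add h id; rewrite add2n.
Qed.

(** * A chart of the blowing up and two of its points *)

Lemma chart_of x : subring (chart O x) /\ O `<=` chart O x.
Proof.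
by split; [exact: subring_gen_subring|move=> a ha; apply: sub_gen_smallest; left].
Qed.

Lemma chartE : chart O y = [set p.[b / y] | p in poly_over O].
Proof.
have hA := subring_gen_subring (O `|` [set b / y]).
rewrite -(adjoinE sO); apply/seteqP; split; apply: smallest_sub.
- exact: subring_gen_subring.
- move=> x [hx|[_ /(rp_gen rp)[u [v [hu hv ->]]] <-]].
    by apply: sub_gen_smallest; left.
  rewrite mulrDl mulfK // -mulrA; apply: (subringD hA); last by apply: sub_gen_smallest; left.
  by apply: (subringM hA); apply: sub_gen_smallest; [left|right].
- exact: subring_gen_subring.
- move=> x [hx|->]; apply: sub_gen_smallest; first by left.
  by right; exists b => //; exact: rp_nonunit1.
Qed.

Let hA := (chart_of y).1.

Lemma chart_horner p : poly_over O p -> chart O y p.[b / y].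
Proof. by move=> hp; rewrite chartE; exists p. Qed.

Lemma except_primeP p : poly_over O p ->
  except_prime O b y p.[b / y] <-> poly_over (nonunits O) p.
Proof.
move=> hp; split=> [[q hq e]|np]; last by exists p.
have hq' := poly_over_sub (@nonunits_sub _ _) hq.
rewrite -(subrK q p) => i; rewrite coefD; apply: (idealD mO) => //.
by apply: quasi_regular; [exact: poly_overB|rewrite hornerD hornerN e subrr].
Qed.

Lemma origin_primeP p : poly_over O p ->
  origin_prime O b y p.[b / y] <-> nonunits O p`_0.
Proof.
move=> hp; split=> [[q [hq q0] e]|np]; last by exists p.
rewrite -(subrK q p) coefD; apply: (idealD mO) => //.
by apply: quasi_regular; [exact: poly_overB|rewrite hornerD hornerN e subrr].
Qed.

Lemma except_prime_prime : prime_ideal (chart O y) (except_prime O b y).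
Proof.
split; first split.
- move=> _ [p hp <-]; apply: chart_horner; exact: (poly_over_sub (@nonunits_sub _ _) hp).
- by exists 0; [move=> i; rewrite coef0; exact: (ideal0 mO)|rewrite horner0].
- move=> _ _ [p hp <-] [q hq <-]; exists (p + q); last by rewrite hornerD.
  by move=> i; rewrite coefD; exact: (idealD mO).
- rewrite chartE => _ _ [p hp <-] [q hq <-]; exists (p * q); last by rewrite hornerM.
  by move=> i; rewrite coefM; apply: (ideal_sum mO) => j _; apply: (ideal_mull mO).
- rewrite -[1](hornerC 1 (b / y)) => /except_primeP -/(_ (poly_overC sO (subring1 sO)))/(_ 0%N).
  by rewrite coefC; exact: nonunits_neq1.
- rewrite chartE => _ _ [p hp <-] [q hq <-]; rewrite -hornerM.
  move/(except_primeP (poly_overM sO hp hq))/(local_gauss hO hp hq).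
  by case=> h; [left|right]; apply/except_primeP.
Qed.

Lemma origin_prime_prime : prime_ideal (chart O y) (origin_prime O b y).
Proof.
split; first split.
- by move=> _ [p [hp _] <-]; apply: chart_horner.
- exists 0; last by rewrite horner0.
  by split; [move=> i|]; rewrite coef0; [exact: subring0|exact: (ideal0 mO)].
- move=> _ _ [p [hp np] <-] [q [hq nq] <-]; exists (p + q); last by rewrite hornerD.
  by split; [exact: poly_overD|rewrite coefD; exact: (idealD mO)].
- rewrite chartE => _ _ [p hp <-] [q [hq nq] <-]; exists (p * q); last by rewrite hornerM.
  by split; [exact: poly_overM|rewrite coefM big_ord1; exact: (ideal_mull mO)].
- rewrite -[1](hornerC 1 (b / y)) => /origin_primeP -/(_ (poly_overC sO (subring1 sO))).
  by rewrite coefC; exact: nonunits_neq1.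
- rewrite chartE => _ _ [p hp <-] [q hq <-]; rewrite -hornerM.
  move/(origin_primeP (poly_overM sO hp hq)); rewrite coefM big_ord1.
  have [_ _ prm] := nonunits_prime hO.
  by move=> /(prm _ _ (hp _) (hq _))[] h; [left|right]; apply/origin_primeP.
Qed.

Lemma nonunits_except_prime : nonunits O `<=` except_prime O b y.
Proof.
move=> x nx; exists x%:P; last by rewrite hornerC.
by move=> i; rewrite coefC; case: eqP => // _; exact: (ideal0 mO).
Qed.

Lemma nonunits_origin_prime : nonunits O `<=` origin_prime O b y.
Proof.
move=> x nx; exists x%:P; last by rewrite hornerC.
by split; [exact: (poly_overC sO (nonunits_sub nx))|rewrite coefC].
Qed.

Lemma except_point_local : local_ring (except_point O b y).
Proof. exact: (localization_local hA except_prime_prime). Qed.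

Lemma origin_point_local : local_ring (origin_point O b y).
Proof. exact: (localization_local hA origin_prime_prime). Qed.

Lemma sub_except_point : O `<=` except_point O b y.
Proof. by move=> x hx; apply: (sub_localization hA except_prime_prime); apply: (chart_of y).2. Qed.

Lemma sub_origin_point : O `<=` origin_point O b y.
Proof. by move=> x hx; apply: (sub_localization hA origin_prime_prime); apply: (chart_of y).2. Qed.

Lemma nonunits_sub_except_point : nonunits O `<=` nonunits (except_point O b y).
Proof. by move=> x /nonunits_except_prime; apply: (localization_nonunits hA except_prime_prime). Qed.

Lemma nonunits_sub_origin_point : nonunits O `<=` nonunits (origin_point O b y).
Proof. by move=> x /nonunits_origin_prime; apply: (localization_nonunits hA origin_prime_prime). Qed.

Lemma except_point_unit p : poly_over O p -> ~ poly_over (nonunits O) p ->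
  unit_of (except_point O b y) p.[b / y].
Proof.
move=> hp np; apply: (localization_unit hA except_prime_prime); first exact: chart_horner.
by move/(except_primeP hp).
Qed.

Lemma except_point_coordinate : except_point O b y (b / y).
Proof.
apply: (sub_localization hA except_prime_prime).
by rewrite -[b / y]hornerX; apply: chart_horner; exact: (poly_overX sO).
Qed.

Lemma origin_point_coordinate : nonunits (origin_point O b y) (b / y).
Proof.
apply: (localization_nonunits hA origin_prime_prime); exists 'X; last by rewrite hornerX.
by split; [exact: (poly_overX sO)|rewrite coefX; exact: (ideal0 mO)].
Qed.

(** Modulo [b / y] the chart is [O] modulo [b], where [y] is regular. *)
Lemma origin_point_regular_pair : regular_pair (origin_point O b y) (b / y) y.
Proof.
have hO' := origin_point_local; have sO' := local_subring hO'.
have mO' := local_ideal hO'.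
split=> //.
- by rewrite mulf_neq0 ?invr_eq0.
- move=> x; split=> [|[u [v [hu hv ->]]]]; last first.
    apply: (idealD mO'); apply: (ideal_mull mO') => //.
      exact: origin_point_coordinate.
    by apply: nonunits_sub_origin_point; exact: rp_nonunit2.
  move=> /(localization_nonunitsP origin_prime_prime)[_ [s [[p [hp np] <-] hs ns ->]]].
  have [_ _ sv] := localization_unit hA origin_prime_prime hs ns.
  have [q [ep eq]] := poly_constant_part p.
  have hq : poly_over O q by move=> i; rewrite eq; apply: hp.
  have [u [v [hu hv e]]] := iffLR (rp_gen rp p`_0) np.
  exists ((q.[b / y] + u * y) / s), (v / s); split.
  + apply: (subringM sO') => //; apply: (subringD sO').
      by apply: (sub_localization hA origin_prime_prime); apply: chart_horner.
    by apply: (subringM sO'); exact: sub_origin_point.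
  + by apply: (subringM sO') => //; exact: sub_origin_point.
  + have s0 := prime_neq0 origin_prime_prime ns.
    by rewrite ep e !hornerS; field; apply/andP.
- move=> _ [al [s [hal hs ns ->]]] [ga [t [hga ht nt e]]].
  move: hal hga e; rewrite chartE => -[p hp <-] [q hq <-] e.
  have s0 := prime_neq0 origin_prime_prime ns.
  have t0 := prime_neq0 origin_prime_prime nt.
  move: (hs) (ht); rewrite chartE => -[s' hs' es] [t' ht' et].
  have [p1 [ep1 hp1]] := poly_constant_part (p * t').
  have hpt := poly_overM sO hp ht'; set c := (p * t')`_0 in ep1.
  have hq1 : poly_over O p1 by move=> i; rewrite hp1; apply: hpt.
  have e' : (p * t').[b / y] * y = b / y * (q * s').[b / y].
    rewrite !hornerM es et.
    have -> : p.[b / y] * t * y = p.[b / y] / s * y / (b / y) * (s * t * (b / y)).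
      by field; rewrite b0 y0 s0.
    by rewrite e; field; rewrite y0 t0.
  have hcy : O (c * y / b).
    apply: (multiple_of_coordinate (q := q * s' - y *: p1)).
    + by apply: (subringM sO) => //; apply: hpt.
    + apply: (poly_overB sO); first exact: poly_overM.
      by move=> i; rewrite coefZ; exact: subringM.
    + rewrite hornerD hornerN hornerZ mulrBr -e' ep1 !hornerS; ring.
  have hc : O (c / b) by apply: (rp_reg rp) => //; apply: hpt.
  rewrite (_ : _ / (b / y) = (p1.[b / y] + y * (c / b)) / (s * t)).
    exists (p1.[b / y] + y * (c / b)), (s * t); split=> //.
    + apply: (subringD hA); first exact: chart_horner.
      by apply: (chart_of y).2; exact: subringM.
    + exact: (subringM hA hs ht).
    + exact: (prime_compl origin_prime_prime hs ht ns nt).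
  have -> : p.[b / y] / s = (p * t').[b / y] / (s * t).
    by rewrite hornerM et; field; apply/andP.
  by rewrite ep1 !hornerS; field; apply/and4P.
Qed.

(** Modulo [b / y] a denominator reduces to its constant coefficient, which is
    a unit of [O]. *)
Lemma origin_point_min T : local_ring T -> O `<=` T -> nonunits T (b / y) ->
  origin_point O b y `<=` T.
Proof.
move=> hT sOT nT; have sT := local_subring hT; have TX := nonunits_sub nT.
apply: (localization_min sT) => [x|x]; rewrite chartE => -[p hp <-].
  exact: (horner_over sT TX (poly_over_sub sOT hp)).
have [q [ep hq]] := poly_constant_part p; rewrite {2}ep hornerMXaddC addrC => np.
apply: (unit_ofD hT); last first.
  apply: (ideal_mull (local_ideal hT)) => //; apply: (horner_over sT TX) => i.
  by rewrite hq; apply: sOT.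
apply: (unit_of_sub sOT); apply: not_nonunit_unit => // np0; apply: np.
by apply/origin_primeP.
Qed.

Lemma origin_point_residue x : origin_point O b y x ->
  exists2 c, O c & nonunits (origin_point O b y) (x - c).
Proof.
case=> al [s [hal hs ns ->]]; move: hal; rewrite chartE => -[p hp <-].
move: hs ns; rewrite chartE => -[q hq <-] nq.
have [q0 hq0 hv] : unit_of O q`_0.
  by apply: not_nonunit_unit => // nq0; apply: nq; apply/origin_primeP.
have qn0 := prime_neq0 origin_prime_prime nq.
exists (p`_0 / q`_0); first exact: subringM.
apply/(localization_nonunitsP origin_prime_prime).
exists (p * (q`_0)%:P - (p`_0)%:P * q).[b / y], (q * (q`_0)%:P).[b / y].
split.
- apply/origin_primeP.
    by apply: (poly_overB sO); apply: (poly_overM sO) => //; exact: poly_overC.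
  by rewrite coefB coefMC coefCM subrr; exact: (ideal0 mO).
- by apply: chart_horner; apply: (poly_overM sO) => //; exact: poly_overC.
- move/origin_primeP => -/(_ (poly_overM sO hq (poly_overC sO (hq 0%N)))).
  rewrite coefMC => h; apply: (unit_not_nonunit (unit_ofM sO _ _) h);
  by split.
- by rewrite !hornerS; field; apply/andP.
Qed.

End RegularPair.

(** * Domination and separatedness *)

Section Domination.
Variable K : fieldType.
Implicit Types (p q T : set K) (s t : seq K).

Lemma lies_over_idP p T :
  lies_over idfun p T <-> p `<=` T /\ nonunits p `<=` nonunits T.
Proof. by rewrite /lies_over !image_id. Qed.

Lemma lies_over_refl p : lies_over idfun p p.
Proof. by apply/lies_over_idP; split. Qed.

Lemma lies_over_trans p q T :
  lies_over idfun p q -> lies_over idfun q T -> lies_over idfun p T.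
Proof.
move=> /lies_over_idP[h1 h2] /lies_over_idP[h3 h4].
by apply/lies_over_idP; split; apply: subset_trans; eauto.
Qed.

Lemma lies_over_unit p T x :
  lies_over idfun p T -> p x -> unit_of T x -> unit_of p x.
Proof.
move=> /lies_over_idP[_ h] px uT; apply: not_nonunit_unit => // /h.
exact: unit_not_nonunit.
Qed.

(** This is the valuative form of separatedness. *)
Definition separated (Y : set (set K)) := forall p q T, Y p -> Y q -> subring T ->
  lies_over idfun p T -> lies_over idfun q T -> p = q.

Lemma localization_dominated A I q T : subring A -> prime_ideal A I -> subring q ->
  lies_over idfun (localization A I) T -> lies_over idfun q T -> A `<=` q ->
  localization A I `<=` q.
Proof.
move=> hA hI hq pT qT Aq; apply: localization_min => // s hs ns.
apply: (lies_over_unit qT); first exact: Aq.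
by case/lies_over_idP: pT => pT _; apply: (unit_of_sub pT); exact: localization_unit.
Qed.

Lemma seq_catP s t q : [set` s ++ t] `<=` q <-> [set` s] `<=` q /\ [set` t] `<=` q.
Proof.
split=> [h|[hs ht] x /=]; last by rewrite mem_cat => /orP[/hs|/ht].
by split=> x hx; apply: h; rewrite /= mem_cat; apply/orP; [left|right].
Qed.

Lemma seq_consP (x : K) s q : [set` x :: s] `<=` q <-> q x /\ [set` s] `<=` q.
Proof.
split=> [h|[hs ht] y /=]; last by rewrite inE => /orP[/eqP->|/ht].
split=> [|y hy]; apply: h; rewrite /= inE ?eqxx //.
by apply/orP; right.
Qed.

Lemma basic_open (Y : set (set K)) s : zariski_open Y [set q | Y q /\ [set` s] `<=` q].
Proof. by split=> [q []//|q [_ hs]]; exists s. Qed.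

Lemma open_generization (Y U : set (set K)) p q :
  zariski_open Y U -> U p -> Y q -> p `<=` q -> U q.
Proof. by move=> [_ h] /h[s sp hU] Yq pq; apply: hU => //; apply: subset_trans pq. Qed.

End Domination.

(** What the inductive construction of the cluster needs to know about a
    surface [Y] and the point [O] to be blown up.  The last two conditions
    express, by means of finitely many regular functions, that [O] is closed:
    it is locally the only common zero of [b] and [y], and each other point
    has a neighbourhood over which nothing dominates [O]. *)
Record blowable (K : fieldType) (Y : set (set K)) (O : set K) (b y : K) : Prop :=
  Blowable {
  bl_local : forall p, Y p -> local_ring p;
  bl_separated : separated Y;
  bl_point : Y O;
  bl_pair : regular_pair O b y;
  bl_isolated : exists s : seq K, [set` s] `<=` O /\
    forall q, Y q -> [set` s] `<=` q -> nonunits q b -> nonunits q y -> q = O;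
  bl_far : forall p, Y p -> p <> O -> exists s : seq K, [set` s] `<=` p /\
    forall T, lies_over idfun O T -> ~ [set` s] `<=` T }.

Lemma pullback_id (K : fieldType) (Y : set (set K)) (C : divisor K) p :
  separated Y -> local_ring p -> effective_divisor Y C -> Y p ->
  pullback idfun Y C p = C p.
Proof.
move=> sY lp [cC eC] Yp; have sp := local_subring lp.
have idC : ideal p (C p).
  have [f [U [_ Up /(_ _ Up)[f0 e]]]] := cC _ Yp; rewrite e; apply: principal_ideal => //.
  by apply: (eC _ Yp); rewrite e; exists 1; [exact: subring1|rewrite mulr1].
apply/seteqP; split=> [w [q [Yq qp]]|w hw].
  by rewrite image_id (sY _ _ _ Yq Yp sp qp (lies_over_refl p)) ideal_gen_id.
by exists p; split=> //; [exact: lies_over_refl|rewrite image_id ideal_gen_id].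
Qed.

Lemma multiplicity_equation (K : fieldType) (D : divisor K) O f b y d :
  regular_pair O b y -> D O = principal O f ->
  multiplicity D O d <->
  ideal_pow O (nonunits O) d f /\ ~ ideal_pow O (nonunits O) d.+1 f.
Proof.
move=> rp e; have sO := local_subring (rp_local rp).
suff h k : D O `<=` ideal_pow O (nonunits O) k <-> ideal_pow O (nonunits O) k f.
  by rewrite /multiplicity !h.
have hI := ideal_pow_ideal k sO; rewrite e; split=> [|h _ [a ha <-]].
  by apply; exists 1; [exact: subring1|rewrite mulr1].
exact: (ideal_mulr hI).
Qed.

(** * The blowing up of a surface at a closed point *)

Section BlowUp.
Variables (K : fieldType) (Y : set (set K)) (O : set K) (b y : K).
Hypothesis bl : blowable Y O b y.

Let rp := bl_pair bl.
Let hO := rp_local rp.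
Let sO := local_subring hO.
Let b0 := rp_neq0 rp.
Let y0 := rp_neq0' rp.
Let nb := rp_nonunit1 rp.
Let ny := rp_nonunit2 rp.
Let Ob := nonunits_sub nb.
Let Oy := nonunits_sub ny.

Lemma chart_point x p : spec_over (chart O x) (nonunits O) p ->
  [/\ local_ring p, chart O x `<=` p & lies_over idfun O p].
Proof.
case=> I [hI nI] <-; have [hA sA] := chart_of O x.
have lp := localization_local hA hI; have Ap := sub_localization hA hI.
split=> //; apply/lies_over_idP; split; first exact: subset_trans Ap.
by move=> z /nI; apply: localization_nonunits.
Qed.

Lemma chart_mem x p a : chart O x `<=` p -> nonunits O a -> p (a / x).
Proof. by move=> Ap na; apply: Ap; apply: sub_gen_smallest; right; exists a. Qed.

Lemma chart_min x p : local_ring p -> lies_over idfun O p -> p (b / x) -> p (y / x) ->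
  chart O x `<=` p.
Proof.
move=> lp /lies_over_idP[Op _] pb py; have sp := local_subring lp.
apply: smallest_sub => // z [/Op//|[_ /(rp_gen rp)[u [v [hu hv ->]]] <-]].
by rewrite mulrDl -!mulrA; apply: (subringD sp); apply: (subringM sp) => //; apply: Op.
Qed.

Lemma exceptional_curveP p : exceptional_curve Y O p <->
  exists x, [/\ x != 0, nonunits O x & spec_over (chart O x) (nonunits O) p].
Proof.
split=> [[[[Yp pO]|//] Op]|[x [x0 nx hx]]]; last first.
  by split; [right; exists x|case: (chart_point hx)].
case: pO; apply: (bl_separated bl Yp (bl_point bl) _ (lies_over_refl p) Op).
exact: (local_subring (bl_local bl Yp)).
Qed.

Lemma blowup_not_exceptional p : Y p -> p <> O -> blowup Y O p /\ ~ exceptional_curve Y O p.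
Proof.
move=> Yp pO; split; first by left.
case=> _ Op; apply: pO; apply: (bl_separated bl Yp (bl_point bl) _ (lies_over_refl p) Op).
exact: (local_subring (bl_local bl Yp)).
Qed.

Lemma blowup_local p : blowup Y O p -> local_ring p.
Proof. by case=> [[/(bl_local bl)]//|[x [_ _ /chart_point[]]]]. Qed.

(** Two points of the blowing up dominated by the same ring are not only over
    the same point of [Y]: if this is [O], they are in a common chart. *)
Lemma blowup_separated : separated (blowup Y O).
Proof.
have sepY := bl_separated bl.
have off p q x T : Y p -> p <> O -> spec_over (chart O x) (nonunits O) q -> subring T ->
    lies_over idfun p T -> lies_over idfun q T -> False.
  move=> Yp pO /chart_point[_ _ Oq] sT pT qT; apply: pO.
  exact: (sepY _ _ _ Yp (bl_point bl) sT pT (lies_over_trans Oq qT)).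
have sub p q x x' T : subring T ->
    [/\ x != 0, nonunits O x & spec_over (chart O x) (nonunits O) p] ->
    [/\ x' != 0, nonunits O x' & spec_over (chart O x') (nonunits O) q] ->
    lies_over idfun p T -> lies_over idfun q T -> p `<=` q.
  move=> sT [x0 nx hp] [x'0 nx' hq] pT qT.
  have [lp Ap Op] := chart_point hp; have [lq Aq Oq] := chart_point hq.
  have sq := local_subring lq.
  have [_ _ qv] : unit_of q (x / x').
    apply: (lies_over_unit qT); first exact: chart_mem.
    move/lies_over_idP: pT => [pT _]; move/lies_over_idP: qT => [qT _].
    split; first by rewrite mulf_neq0 ?invr_eq0.
      by apply: qT; exact: chart_mem.
    by rewrite invf_div; apply: pT; exact: chart_mem.
  case: hp pT => I [hI _] <- pT.
  apply: localization_dominated pT qT _ => //; first exact: (chart_of O x).1.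
  have quot a : nonunits O a -> q (a / x).
    move=> na; rewrite (_ : a / x = a / x' * (x / x')^-1); last by field; rewrite x0 x'0.
    by apply: (subringM sq) => //; exact: chart_mem.
  by apply: chart_min => //; exact: quot.
move=> p q T [[Yp pO]|[x hx]] [[Yq qO]|[x' hx']] sT pT qT.
- exact: (sepY _ _ _ Yp Yq sT pT qT).
- by case: hx' => _ _ hx'; case: (off _ _ _ _ Yp pO hx' sT pT qT).
- by case: hx => _ _ hx; case: (off _ _ _ _ Yq qO hx sT qT pT).
- by apply/seteqP; split; [exact: (sub _ _ _ _ T sT hx hx')|exact: (sub _ _ _ _ T sT hx' hx)].
Qed.

Lemma origin_point_exceptional : exceptional_curve Y O (origin_point O b y).
Proof.
apply/exceptional_curveP; exists y; split=> //; exists (origin_prime O b y) => //.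
by split; [exact: origin_prime_prime|exact: nonunits_origin_prime].
Qed.

Lemma except_point_exceptional : exceptional_curve Y O (except_point O b y).
Proof.
apply/exceptional_curveP; exists y; split=> //; exists (except_prime O b y) => //.
by split; [exact: except_prime_prime|exact: nonunits_except_prime].
Qed.

(** [q] contains the chart with coordinate [b / y] and cuts out there the ideal
    of the origin; separatedness does the rest. *)
Lemma origin_point_unique q : blowup Y O q -> lies_over idfun O q ->
  nonunits q (b / y) -> q = origin_point O b y.
Proof.
move=> hq Oq nq; have lq := blowup_local hq; have sq := local_subring lq.
have rp' := origin_point_regular_pair rp.
apply: (blowup_separated hq origin_point_exceptional.1 sq (lies_over_refl q)).
have /lies_over_idP[hOq nOq] := Oq.
have O'q := origin_point_min rp lq hOq nq.
apply/lies_over_idP; split=> // z /(rp_gen rp')[u [v [hu hv ->]]].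
have Iq := local_ideal lq; apply: (idealD Iq).
  by apply: (ideal_mull Iq) => //; exact: O'q.
by apply: (ideal_mull Iq); [exact: O'q|exact: nOq].
Qed.

(** Away from the exceptional curve everything is inherited from [Y], because a
    ring dominating the origin dominates [O].  On the exceptional curve, the
    origin is the only point at which [b / y] vanishes, and at any other point
    its inverse [y / b] is regular. *)
Lemma blowup_blowable : blowable (blowup Y O) (origin_point O b y) (b / y) y.
Proof.
have rp' := origin_point_regular_pair rp.
split=> //.
- exact: blowup_local.
- exact: blowup_separated.
- exact: origin_point_exceptional.1.
- have [s [sO' hs]] := bl_isolated bl; exists (b / y :: s); split.
    apply/seq_consP; split; first exact: (nonunits_sub (origin_point_coordinate rp)).
    exact: subset_trans sO' (sub_origin_point rp).
  move=> q hq /seq_consP[qb sq] nqb nqy.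
  have lq := blowup_local hq.
  case: (hq) => [[Yq qO]|[x [_ _ /chart_point[_ _ Oq]]]]; last exact: origin_point_unique.
  case: qO; apply: hs => //; rewrite -(divfK y0 b).
  exact: (ideal_mulr (local_ideal lq) (nonunits_sub nqy)).
- move=> p hp pO'.
  have O'O : lies_over idfun O (origin_point O b y).
    by apply/lies_over_idP; split; [exact: sub_origin_point|exact: nonunits_sub_origin_point].
  case: (hp) => [[Yp pO]|[x [x0 nx hx]]].
    have [s [sp hs]] := bl_far bl Yp pO; exists s; split=> // T OT.
    exact/hs/(lies_over_trans O'O).
  have [lp Ap Op] := chart_point hx; have spp := local_subring lp.
  suff pyb : p (y / b).
    exists [:: y / b]; split; first by apply/seq_consP.
    move=> T /lies_over_idP[_ nT] /seq_consP[Tyb _].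
    have := nT _ (origin_point_coordinate rp).
    apply: unit_not_nonunit; split; rewrite ?invf_div ?mulf_neq0 ?invr_eq0 //.
    by apply: nonunits_sub; apply: nT; exact: origin_point_coordinate.
  have pb := chart_mem Ap nb; have py := chart_mem Ap ny.
  have [uy|nuy] := unit_or_nonunit py; last first.
    have [u [v [hu hv e]]] := iffLR (rp_gen rp x) nx.
    have /lies_over_idP[hOp _] := Op.
    have [|nub] := unit_or_nonunit pb.
      case=> _ _; rewrite invf_div => pv; rewrite (_ : y / b = y / x * (x / b)).
        exact: subringM.
      by field; rewrite ?x0 ?b0 ?y0.
    case: (nonunits_neq1 lp); rewrite -(divff x0) {1}e mulrDl -!mulrA.
    apply: (idealD (local_ideal lp)); apply: (ideal_mull (local_ideal lp)) => //; exact: hOp.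
  have pby : p (b / y).
    case: uy => _ _; rewrite invf_div => pv; rewrite (_ : b / y = b / x * (x / y)).
      exact: subringM.
    by field; rewrite ?x0 ?b0 ?y0.
  have [[_ _]|npby] := unit_or_nonunit pby; first by rewrite invf_div.
  by case: pO'; exact: origin_point_unique.
Qed.

(** * The strict transform of an effective divisor *)

(** The total transform of [C] minus [d] times the exceptional curve, [x] being
    a local equation of this curve, and [f] one of [C] at [O]. *)
Definition proper_transform (C : divisor K) (f : K) (d : nat) : divisor K := fun p =>
  [set w | (exceptional_curve Y O p /\ exists x,
     [/\ x != 0, nonunits O x, chart O x `<=` p & principal p (f / x ^+ d) w]) \/
     (~ exceptional_curve Y O p /\ pullback idfun Y C p w)].

Section ProperTransform.
Variables (C : divisor K) (f : K) (d : nat).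
Hypotheses (eC : effective_divisor Y C) (fC : local_equation C O f).
Hypothesis (fd : ideal_pow O (nonunits O) d f).
Hypothesis (nfd : ~ ideal_pow O (nonunits O) d.+1 f).

Let C' := proper_transform C f d.

(** Any two local equations of the exceptional curve differ by a unit. *)
Lemma proper_transform_exceptional p x : exceptional_curve Y O p -> x != 0 ->
  nonunits O x -> chart O x `<=` p -> C' p = principal p (f / x ^+ d).
Proof.
move=> hp x0 nx Ap; have sp := local_subring (blowup_local hp.1).
apply/seteqP; split=> [w [[_ [x' [x'0 nx' Ap' hw]]]|[]//]|w hw]; last first.
  by left; split=> //; exists x.
rewrite -(principal_unit (f / x ^+ d) sp (u := (x / x') ^+ d)).
- rewrite (_ : f / x ^+ d * (x / x') ^+ d = f / x' ^+ d) //.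
  by rewrite expr_div_n; field; rewrite !expf_neq0.
- by rewrite expf_neq0 // mulf_neq0 ?invr_eq0.
- by apply: (subringX sp); exact: chart_mem.
- by rewrite -exprVn invf_div; apply: (subringX sp); exact: chart_mem.
Qed.

Lemma proper_transform_off p : Y p -> p <> O -> C' p = C p.
Proof.
move=> Yp pO; have [_ nE] := blowup_not_exceptional Yp pO.
have sep := bl_separated bl.
rewrite -(pullback_id sep (bl_local bl Yp) eC Yp).
by apply/seteqP; split=> [w [[]//|[]]|w hw] //; right.
Qed.

(** The delicate points are those of the exceptional curve: as [O] is locally
    the only common zero of [b] and [y], and these are multiples of [x] near
    the point, [x] is invertible near it off the exceptional curve. *)
Lemma proper_transform_cartier : cartier_divisor (blowup Y O) C'.
Proof.
move=> p hp; have [lp spp] := (blowup_local hp, local_subring (blowup_local hp)).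
have [f0 _] := fC; have [cC _] := eC.
case: (hp) => [[Yp pO]|[x [x0 nx /chart_point[_ Ap Op]]]].
  have [g [U [oU Up hU]]] := cC _ Yp; have [s [sp hs]] := bl_far bl Yp pO.
  have [t tp ht] := oU.2 _ Up.
  exists g, [set q | blowup Y O q /\ [set` s ++ t] `<=` q].
  split; first exact: basic_open; first by split=> //; apply/seq_catP.
  move=> q [[[Yq qO]|[x [_ _ /chart_point[_ _ Oq]]]] /seq_catP[sq tq]]; last by case: (hs _ Oq).
  by have := hU q (ht q Yq tq); rewrite /local_equation proper_transform_off.
have [g [U [oU UO hU]]] := cC _ (bl_point bl).
have [t tO ht] := oU.2 _ UO; have [s [sO' hs]] := bl_isolated bl.
have /lies_over_idP[hOp _] := Op.
(* The equation f of C at O and the equation g valid on U differ by a unit of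
   O, which has to be a unit on the neighbourhood as well. *)
have [[g0 gO] [_ fO]] := (hU _ UO, fC).
have Ofg : O (f / g).
  by apply/(principalP _ _ g0); rewrite -gO fO; exists 1; [exact: subring1|rewrite mulr1].
have Ogf : O (g / f).
  by apply/(principalP _ _ f0); rewrite -fO gO; exists 1; [exact: subring1|rewrite mulr1].
pose l := [:: b / x, y / x, x, f / g & [:: g / f]] ++ s ++ t.
exists (f / x ^+ d), [set q | blowup Y O q /\ [set` l] `<=` q].
split; first exact: basic_open.
  split=> //; apply/seq_catP; split; last first.
    by apply/seq_catP; split; apply: subset_trans hOp.
  do 2!(apply/seq_consP; split; first exact: chart_mem).
  apply/seq_consP; split; first exact: (hOp _ (nonunits_sub nx)).
  by do 2!(apply/seq_consP; split; first exact: hOp).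
move=> q [hq /seq_catP[+ /seq_catP[sq tq]]].
case/seq_consP=> qb /seq_consP[qy /seq_consP[qx /seq_consP[qfg /seq_consP[qgf _]]]].
have lq := blowup_local hq; have sqq := local_subring lq.
have fx0 : f / x ^+ d != 0 by rewrite mulf_neq0 // invr_eq0 expf_neq0.
split=> //; case: (hq) => [[Yq qO]|[x' [x'0 nx' /chart_point[_ Ap' Oq]]]]; last first.
  apply: proper_transform_exceptional => //; exact: chart_min.
have [_ gq] := hU q (ht q Yq tq); rewrite proper_transform_off // gq.
have [_ _ qxv] : unit_of q x.
  apply: not_nonunit_unit => // nqx; apply: qO; apply: hs => //.
    by rewrite -(divfK x0 b); apply: (ideal_mull (local_ideal lq)).
  by rewrite -(divfK x0 y); apply: (ideal_mull (local_ideal lq)).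
rewrite (_ : f / x ^+ d = g * (f / g / x ^+ d)); last by field; rewrite expf_neq0.
rewrite principal_unit //.
- by rewrite !mulf_neq0 ?invr_eq0 ?expf_neq0.
- by apply: (subringM sqq) => //; rewrite -exprVn; exact: subringX.
- rewrite [X in q X](_ : _ = g / f * x ^+ d); last by field; rewrite f0 g0 expf_neq0.
  by apply: (subringM sqq) => //; exact: subringX.
Qed.

Lemma proper_transform_effective : effective_divisor (blowup Y O) C'.
Proof.
split; first exact: proper_transform_cartier.
move=> p hp; have spp := local_subring (blowup_local hp).
case: (hp) => [[Yp pO]|[x [x0 nx hx]]]; first by rewrite proper_transform_off //; exact: eC.2.
have [_ Ap Op] := chart_point hx.
have hE : exceptional_curve Y O p by apply/exceptional_curveP; exists x.
rewrite (proper_transform_exceptional hE x0 nx Ap).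
move=> _ [c pc <-]; apply: (subringM spp) => //.
have /lies_over_idP[hOp _] := Op.
have [q [hq sq ->]] := iffLR (ideal_powP rp d f) fd.
rewrite horner_coef mulr_sumr mulr_suml; apply: (subring_sum spp) => i _.
have id : (i <= d)%N by rewrite -ltnS (leq_trans (ltn_ord i)).
rewrite (_ : _ / _ = q`_i * (b / x) ^+ i * (y / x) ^+ (d - i)).
  by apply: (subringM spp); [apply: (subringM spp); first exact: hOp|]; apply: (subringX spp); exact: chart_mem.
rewrite -{1 2}(subnK id) !exprD !expr_div_n; field.
by rewrite !expf_neq0.
Qed.

(** The equation of the proper transform is the dehomogenized leading form of
    [f], which does not vanish identically on the exceptional curve. *)
Lemma proper_transform_generic : C' (except_point O b y) 1.
Proof.
have hE := except_point_exceptional.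
have Ay : chart O y `<=` except_point O b y.
  by apply: (sub_localization (chart_of O y).1 (except_prime_prime rp)).
rewrite (proper_transform_exceptional hE y0 ny Ay).
have [p [hp sp e np]] := leading_form rp fd nfd.
have [u0 hu hv] := except_point_unit rp hp np.
exists p.[b / y]^-1 => //; rewrite e; field.
by rewrite u0 expf_neq0.
Qed.

Lemma proper_transform_strict : strict_transform Y O C C'.
Proof.
split; first exact: proper_transform_effective.
  by move=> p hp nE; apply/seteqP; split=> [w [[]//|[]]|w hw] //; right.
move=> /(_ _ except_point_exceptional)[_]; apply.
exact: proper_transform_generic.
Qed.

Lemma proper_transform_origin :
  local_equation C' (origin_point O b y) (f / y ^+ d).
Proof.
have [f0 _] := fC; split; first by rewrite mulf_neq0 // invr_eq0 expf_neq0.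
apply: proper_transform_exceptional => //; first exact: origin_point_exceptional.
by apply: (sub_localization (chart_of O y).1 (origin_prime_prime rp)).
Qed.

End ProperTransform.
End BlowUp.

(** * Hilbert's basis theorem *)

Section HilbertBasis.
Variables (K : fieldType) (A : set K) (x : K).
Hypotheses (hA : subring A) (nA : noetherian A).
Implicit Types (I J : set K) (s G : seq K) (d : nat).

Let B := subring_gen (A `|` [set x]).
Let hB : subring B := subring_gen_subring _.

Let horner_adjoin p : poly_over A p -> B p.[x].
Proof. by move=> hp; rewrite /B (adjoinE hA); exists p. Qed.

Definition leading_ideal I d : set K :=
  [set a | exists p, [/\ poly_over A p, (size p <= d.+1)%N, I p.[x] & p`_d = a]].

Lemma leading_ideal_ideal I d : ideal B I -> ideal A (leading_ideal I d).
Proof.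
move=> hI; split.
- by move=> _ [p [hp _ _ <-]]; apply: hp.
- exists 0; split; rewrite ?coef0 ?size_poly0 ?horner0 //; last exact: (ideal0 hI).
  by move=> i; rewrite coef0; exact: subring0.
- move=> _ _ [p [hp sp ip <-]] [q [hq sq iq <-]]; exists (p + q); split.
  + exact: poly_overD.
  + by apply: leq_trans (size_polyD _ _) _; rewrite geq_max sp.
  + by rewrite hornerD; exact: (idealD hI).
  + by rewrite coefD.
- move=> a _ ha [p [hp sp ip <-]]; exists (a *: p); split.
  + by move=> i; rewrite coefZ; exact: subringM.
  + exact: leq_trans (size_scale_leq _ _) sp.
  + rewrite hornerZ; apply: (ideal_mull hI) => //.
    by rewrite -(hornerC a x); apply: horner_adjoin; exact: poly_overC.
  + by rewrite coefZ.
Qed.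

Lemma leading_ideal_le I d e : ideal B I -> (d <= e)%N ->
  leading_ideal I d `<=` leading_ideal I e.
Proof.
move=> hI de _ [p [hp sp ip <-]]; exists (p * 'X^(e - d)); split.
- apply: poly_overM => //; apply: poly_overXn => //; exact: poly_overX.
- apply: leq_trans (size_polyMleq _ _) _; rewrite size_polyXn addnS /=.
  by rewrite -{2}(subnKC de) -addSn leq_add2r.
- rewrite hornerM hornerXn; apply: (ideal_mulr hI) => //.
  by rewrite -hornerXn; apply: horner_adjoin; apply: poly_overXn => //; exact: poly_overX.
- by rewrite coefMXn ltnNge leq_subr /= subKn.
Qed.

(** The leading term of an element of [I] can be cancelled by an element of [J],
    until nothing is left. *)
Lemma leading_ideal_incl I J : ideal B I -> ideal B J -> J `<=` I ->
  (forall d, leading_ideal I d `<=` leading_ideal J d) -> I `<=` J.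
Proof.
move=> hI hJ JI h w Iw; have := ideal_sub hI Iw; rewrite /B (adjoinE hA) => -[p hp e].
rewrite -e in Iw *; move: {2}(size p) (leqnn (size p)) => n.
elim: n p {e} hp Iw => [|n IH] p hp Ip.
  by rewrite leqn0 size_poly_eq0 => /eqP ->; rewrite horner0 => *; exact: (ideal0 hJ).
move=> sp; have [|q [hq sq Jq e]] := h n p`_n; first by exists p.
rewrite -(subrK q p) hornerD; apply: (idealD hJ) => //.
apply: IH; first exact: poly_overB.
  by rewrite hornerD hornerN; apply: (idealB hB hI) => //; exact: JI.
apply/leq_sizeP => i; rewrite leq_eqVlt coefB => /orP[/eqP <-|ni].
  by rewrite e subrr.
by move/leq_sizeP: sp => ->//; move/leq_sizeP: sq => ->//; rewrite subrr.
Qed.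

Let represent I d s : ideal B I -> [set` s] `<=` leading_ideal I d ->
  exists G, [set` G] `<=` I /\
    forall J, ideal B J -> [set` G] `<=` J -> [set` s] `<=` leading_ideal J d.
Proof.
move=> hI; elim: s => [|a s IH]; first by exists [::].
move=> /seq_consP[[p [hp sp Ip ep]] /IH[G [GI hG]]].
exists (p.[x] :: G); split; first by apply/seq_consP.
move=> J hJ /seq_consP[Jp GJ]; apply/seq_consP; split; last exact: hG.
by exists p.
Qed.

Let represent_all I n : ideal B I -> exists G, [set` G] `<=` I /\
  forall J, ideal B J -> [set` G] `<=` J ->
    forall d, (d < n)%N -> leading_ideal I d `<=` leading_ideal J d.
Proof.
move=> hI; elim: n => [|n [G [GI hG]]]; first by exists [::].
have hL := leading_ideal_ideal n hI; have [s es] := nA hL.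
have [|G' [GI' hG']] := represent (s := s) (d := n) hI.
  by rewrite es; exact: subset_ideal_gen.
exists (G ++ G'); split; first by apply/seq_catP.
move=> J hJ /seq_catP[GJ GJ'] d; rewrite ltnS leq_eqVlt => /orP[/eqP->|/(hG _ hJ GJ)//].
by rewrite es; apply: ideal_gen_min; [exact: leading_ideal_ideal|exact: hG'].
Qed.

(** The increasing sequence of the leading ideals of [I] stabilizes, so that
    finitely many elements of [I] generate an ideal with the same leading
    ideals in all degrees. *)
Theorem hilbert_basis : noetherian (subring_gen (A `|` [set x])).
Proof.
rewrite -/B => I hI.
have hL : ideal A [set a | exists d, leading_ideal I d a].
  split.
  - by move=> a [d /(ideal_sub (leading_ideal_ideal d hI))].
  - by exists 0%N; exact: (ideal0 (leading_ideal_ideal 0 hI)).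
  - move=> a c [d ha] [e hc]; exists (maxn d e).
    apply: (idealD (leading_ideal_ideal _ hI)).
      exact: (leading_ideal_le hI (leq_maxl d e)).
    exact: (leading_ideal_le hI (leq_maxr d e)).
  - by move=> a c ha [d hc]; exists d; exact: (ideal_mull (leading_ideal_ideal d hI)).
have [s es] := nA hL.
have [D hD] : exists D, [set` s] `<=` leading_ideal I D.
  have : [set` s] `<=` [set a | exists d, leading_ideal I d a].
    by rewrite es; exact: subset_ideal_gen.
  elim: (s) => [|a s' IH]; first by exists 0%N.
  move=> /seq_consP[[d ha] /IH[D hD]]; exists (maxn d D); apply/seq_consP; split.
    exact: (leading_ideal_le hI (leq_maxl d D)).
  exact: subset_trans hD (leading_ideal_le hI (leq_maxr d D)).
have [G [GI hG]] := represent_all D.+1 hI; exists G.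
have hJ := ideal_gen_ideal hB (subset_trans GI (ideal_sub hI)).
have JI := ideal_gen_min hI GI; apply/seteqP; split=> //.
apply: leading_ideal_incl => // d.
have [dD|Dd] := leqP d D; first exact: hG (@subset_ideal_gen _ _ _) _ dD.
move=> a ha; apply: (leading_ideal_le hJ (ltnW Dd)).
apply: (hG _ hJ (@subset_ideal_gen _ _ _) D) => //.
suff: ideal_gen A [set` s] `<=` leading_ideal I D by apply; rewrite -es; exists d.
exact: ideal_gen_min (leading_ideal_ideal D hI) hD.
Qed.

End HilbertBasis.

Lemma noetherian_adjoin (K : fieldType) (A : set K) (s : seq K) :
  subring A -> noetherian A -> noetherian (subring_gen (A `|` [set` s])).
Proof.
move=> hA nA; elim: s => [|x s IH].
  rewrite (_ : subring_gen _ = A) //; apply/seteqP; split.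
    by apply: smallest_sub => // z [].
  by move=> z hz; apply: sub_gen_smallest; left.
set A' := subring_gen (A `|` [set` s]) in IH *.
have hA' : subring A' := subring_gen_subring _.
rewrite (_ : subring_gen _ = subring_gen (A' `|` [set x])); first exact: hilbert_basis.
apply/seteqP; split; apply: smallest_sub; try exact: subring_gen_subring.
  move=> z [hz|]; first by apply: sub_gen_smallest; left; apply: sub_gen_smallest; left.
  rewrite /= inE => /orP[/eqP->|hz]; first by apply: sub_gen_smallest; right.
  by apply: sub_gen_smallest; left; apply: sub_gen_smallest; right.
move=> z [hz|->]; last by apply: sub_gen_smallest; right; rewrite /= mem_head.
apply: smallest_sub hz; first exact: subring_gen_subring.
move=> u [hu|hu]; apply: sub_gen_smallest; first by left.
by right; rewrite /= inE; apply/orP; right.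
Qed.

Lemma range_subring (k K : fieldType) (iota : {rmorphism k -> K}) : subring (range iota).
Proof.
apply/subringP; split.
- by exists 1; rewrite ?rmorph1.
- by move=> _ _ [u _ <-] [v _ <-]; exists (u - v); rewrite ?rmorphB.
- by move=> _ _ [u _ <-] [v _ <-]; exists (u * v); rewrite ?rmorphM.
Qed.

Lemma range_noetherian (k K : fieldType) (iota : {rmorphism k -> K}) :
  noetherian (range iota).
Proof.
move=> I hI; have hA := range_subring iota.
have [[a [Ia a0]]|h] := pselect (exists a, I a /\ a != 0).
  exists [:: a]; apply/seteqP; split.
    move=> z Iz; have [u _ eu] := ideal_sub hI Iz; have [v _ ev] := ideal_sub hI Ia.
    have -> : z = iota (u / v) * a by rewrite fmorph_div eu ev divfK.
    have hg : ideal (range iota) (ideal_gen (range iota) [set` [:: a]]).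
      apply: ideal_gen_ideal => // z' /=; rewrite inE => /eqP ->; exact: (ideal_sub hI).
    apply: (ideal_mull hg); first by exists (u / v).
    by apply: subset_ideal_gen; rewrite /= mem_head.
  by apply: (ideal_gen_min hI) => z; rewrite /= inE => /eqP ->.
exists [::]; apply/seteqP; split=> [z Iz|].
  have -> : z = 0 by apply/eqP/negPn/negP => z0; apply: h; exists z.
  by apply: (ideal0 (ideal_gen_ideal hA _)).
exact: (ideal_gen_min hI).
Qed.

(** * Points of a projective variety *)

Section Projective.
Variables (k K : fieldType) (iota : {rmorphism k -> K}) (N : nat) (x : 'I_N.+1 -> K).

Let A j := affine_chart iota x j.
Let Y := \bigcup_(j in [set j | x j != 0]) spec (A j).

Let hA j : subring (A j) := subring_gen_subring _.

Let chart_scalar j : range iota `<=` A j.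
Proof. by move=> z hz; apply: sub_gen_smallest; left. Qed.

Let chart_ratio i j : A j (x i / x j).
Proof. by apply: sub_gen_smallest; right; exists i. Qed.

Let chart_le j T : subring T -> range iota `<=` T -> (forall i, T (x i / x j)) ->
  A j `<=` T.
Proof. by move=> hT sT rT; apply: smallest_sub => // z [/sT//|[i _ <-]]. Qed.

Let ratios j : seq K := codom (fun i => x i / x j).

Let ratiosP j (T : set K) : [set` ratios j] `<=` T <-> forall i, T (x i / x j).
Proof.
split=> [h i|h _ /codomP[i ->]]; last exact: h.
by apply: h; exact: (codom_f (fun i => x i / x j)).
Qed.

Lemma affine_chart_noetherian j : noetherian (A j).
Proof.
rewrite /A /affine_chart (_ : range (fun i => x i / x j) = [set` ratios j]).
  exact: (noetherian_adjoin (range_subring iota) (@range_noetherian _ _ iota)).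
apply/seteqP; split=> [_ [i _ <-]|z /codomP[i ->]]; last by exists i.
exact: (codom_f (fun i => x i / x j)).
Qed.

Let pointP p : Y p <->
  exists j I, [/\ x j != 0, prime_ideal (A j) I & p = localization (A j) I].
Proof.
split=> [[j x0 [I [hI _] <-]]|[j [I [x0 hI ->]]]]; first by exists j, I.
by exists j => //; exists I; rewrite ?/=; split.
Qed.

Lemma projective_local p : Y p -> local_ring p.
Proof. by case/pointP=> j [I [x0 hI ->]]; exact: localization_local. Qed.

Let point_chart p : Y p -> exists j, x j != 0 /\ A j `<=` p.
Proof. by case/pointP=> j [I [x0 hI ->]]; exists j; split=> //; exact: sub_localization. Qed.

(** A local ring [p] of the chart [j] contains [x i / x j], which is invertible
    in [T], its inverse being [x j / x i]; hence it is invertible in [p]. *)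
Let chart_descends p T i : Y p -> lies_over idfun p T ->
  x i != 0 -> (forall l, T (x l / x i)) -> A i `<=` p.
Proof.
move=> Yp pT xi rT; have sp := local_subring (projective_local Yp).
have [j [xj Ap]] := point_chart Yp; have /lies_over_idP[sT _] := pT.
have [_ _ hv] : unit_of p (x i / x j).
  apply: (lies_over_unit pT); first exact: Ap.
  split; first by rewrite mulf_neq0 ?invr_eq0.
    by apply: sT; exact: Ap.
  by rewrite invf_div.
apply: chart_le => // [z /(chart_scalar (j := j))/Ap//|l].
rewrite (_ : x l / x i = x l / x j * (x i / x j)^-1); last by field; rewrite xi xj.
by apply: (subringM sp) => //; exact: Ap.
Qed.

Lemma projective_separated : separated Y.
Proof.
move=> p q T; have sub p' q' : Y p' -> Y q' -> subring T -> lies_over idfun p' T ->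
    lies_over idfun q' T -> p' `<=` q'.
  move=> Yp Yq sT pT qT; have [j [I [xj hI e]]] := iffLR (pointP p') Yp.
  rewrite e in pT *; apply: (localization_dominated _ hI _ pT qT) => //.
    exact: (local_subring (projective_local Yq)).
  apply: (chart_descends Yq qT xj) => l.
  by case/lies_over_idP: pT => + _; apply; exact: sub_localization.
by move=> *; apply/seteqP; split; exact: sub.
Qed.

(** Localizing twice amounts to localizing once, at the trace of the prime. *)
Lemma projective_generization p J : Y p -> prime_ideal p J -> Y (localization p J).
Proof.
move=> Yp hJ; have sp := local_subring (projective_local Yp).
have [j [I [xj hI e]]] := iffLR (pointP p) Yp; apply/pointP.
have Ap : A j `<=` p by rewrite e; exact: sub_localization.
have [J0 nJ mJ] := hJ; exists j, (A j `&` J); split=> //.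
  split; [split|by case|].
  - by move=> z [].
  - by split; [exact: (subring0 (hA j))|exact: (ideal0 J0)].
  - by move=> u v [? ?] [? ?]; split; [exact: (subringD (hA j))|exact: (idealD J0)].
  - by move=> a u ha [? ?]; split; [exact: (subringM (hA j))|apply: (ideal_mull J0) => //; exact: Ap].
  - move=> u v hu hv [_ /mJ[]]; [exact: Ap|exact: Ap| |]; by [left|right].
apply/seteqP; split=> [_ [a [s [+ + ns ->]]]|_ [a [s [ha hs ns ->]]]]; last first.
  by exists a, s; split; [exact: Ap|exact: Ap| |]; [move=> h; apply: ns|].
rewrite {1 2}e => -[a1 [a2 [ha1 ha2 na2 ea]]] [s1 [s2 [hs1 hs2 ns2 es]]].
have a0 := prime_neq0 hI na2; have s0 := prime_neq0 hI ns2.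
have [_ _ a2v] : unit_of p a2 by rewrite e; exact: localization_unit.
have s10 : s1 != 0.
  by apply/eqP => s10; apply: ns; rewrite es s10 mul0r; exact: (ideal0 J0).
exists (a1 * s2), (a2 * s1); split.
- exact: (subringM (hA j)).
- exact: (subringM (hA j)).
- case=> _ /mJ[]; [exact: Ap|exact: Ap| |] => h.
    by apply: nJ; rewrite -(mulVf a0); apply: (ideal_mull J0).
  apply: ns; rewrite es; apply: (ideal_mulr J0) => //.
  by rewrite e; case: (localization_unit (hA j) hI hs2 ns2).
- by rewrite ea es; field; rewrite a0 s0 s10.
Qed.

(** By the basis theorem, the prime of [O] in the coordinate ring of a chart has
    finitely many generators; these are combinations of [b] and [y] with
    coefficients regular near [O], hence a common zero of [b] and [y] near [O]
    is a specialization of the closed point [O].  As for another point [p] in a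
    chart containing [O], some function on the chart vanishes at [O] but not at
    [p], again because [O] is closed. *)
Lemma projective_blowable O b y : closed_point Y O -> regular_pair O b y ->
  blowable Y O b y.
Proof.
case=> YO cO rp; have sep := projective_separated.
have nb := rp_nonunit1 rp; have ny := rp_nonunit2 rp.
split=> //; first exact: projective_local.
- have [j [I [xj hI e]]] := iffLR (pointP O) YO.
  have [I0 _ _] := hI; have [g eg] := affine_chart_noetherian I0.
  have AO : A j `<=` O by rewrite e; exact: sub_localization.
  have : [set` g] `<=` nonunits O.
    move=> z hz; rewrite e; apply: localization_nonunits => //.
    by rewrite eg; exact: subset_ideal_gen.
  move=> gO; have {gO}[t [tO ht]] : exists t : seq K, [set` t] `<=` O /\
      forall q, local_ring q -> [set` t] `<=` q -> nonunits q b -> nonunits q y ->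
        [set` g] `<=` nonunits q.
    elim: g {eg} gO => [_|z g IH /seq_consP[nz /IH[t [tO ht]]]]; first by exists [::].
    have [u [v [hu hv ez]]] := iffLR (rp_gen rp z) nz.
    exists [:: u, v & t]; split; first by do 2!(apply/seq_consP; split=> //).
    move=> q lq /seq_consP[qu /seq_consP[qv tq]] qb qy.
    apply/seq_consP; split; last exact: ht.
    by rewrite ez; apply: (idealD (local_ideal lq)); apply: (ideal_mull (local_ideal lq)).
  exists (ratios j ++ t); split.
    by apply/seq_catP; split=> //; apply/ratiosP => i; exact: AO.
  move=> q Yq /seq_catP[/ratiosP rq tq] qb qy.
  have lq := projective_local Yq; have sq := local_subring lq.
  have Aq : A j `<=` q := chart_descends Yq (lies_over_refl q) xj rq.
  have Iq : I `<=` nonunits q.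
    move=> z Iz; suff: ideal_gen (A j) [set` g] `<=` A j `&` nonunits q.
      by rewrite -eg => /(_ _ Iz)[].
    apply: ideal_gen_min => [|w hw]; last first.
      split; last exact: ht hw.
      by apply: (ideal_sub I0); rewrite eg; exact: subset_ideal_gen.
    have lI := local_ideal lq; split.
    + by move=> w [].
    + by split; [exact: (subring0 (hA j))|exact: (ideal0 lI)].
    + by move=> u v [? ?] [? ?]; split; [exact: (subringD (hA j))|exact: (idealD lI)].
    + by move=> a u ha [? ?]; split; [exact: (subringM (hA j))|apply: (ideal_mull lI) => //; exact: Aq].
  have hJ : prime_ideal (A j) (A j `&` nonunits q).
    have [lI l1 lm] := nonunits_prime lq; split; [split|by case|].
    + by move=> w [].
    + by split; [exact: (subring0 (hA j))|exact: (ideal0 lI)].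
    + by move=> u v [? ?] [? ?]; split; [exact: (subringD (hA j))|exact: (idealD lI)].
    + by move=> a u ha [? ?]; split; [exact: (subringM (hA j))|apply: (ideal_mull lI) => //; exact: Aq].
    + move=> u v hu hv [_ /lm[]]; [exact: Aq|exact: Aq| |]; by [left|right].
  have YJ : Y (localization (A j) (A j `&` nonunits q)).
    by apply/pointP; exists j, (A j `&` nonunits q).
  have eO : localization (A j) (A j `&` nonunits q) = O.
    apply: cO YJ _; rewrite e => _ [a [s [ha hs ns ->]]]; exists a, s; split=> // Is.
    by apply: ns; split=> //; exact: Iq.
  rewrite -eO; apply: (sep _ _ _ Yq YJ sq (lies_over_refl q)); apply/lies_over_idP; split.
    apply: localization_min => // s hs ns; apply: not_nonunit_unit; first exact: Aq.
    by move=> nqs; apply: ns.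
  move=> _ /(localization_nonunitsP hJ)[a [s [[ha na] hs ns ->]]].
  have [_ _ qv] : unit_of q s.
    by apply: not_nonunit_unit; [exact: Aq|move=> nqs; apply: ns].
  exact: (ideal_mulr (local_ideal lq)).
- move=> p Yp pO; have [j [I [xj hI e]]] := iffLR (pointP p) Yp.
  have Ap : A j `<=` p by rewrite e; exact: sub_localization.
  have sO := local_subring (projective_local YO).
  have sp := local_subring (projective_local Yp).
  have [AO|nAO] := pselect (A j `<=` O); last first.
    exists (ratios j); split; first by apply/ratiosP => i; exact: Ap.
    by move=> T OT /ratiosP rT; apply: nAO; exact: (chart_descends YO OT xj rT).
  have [t [ut nt]] : exists t, unit_of p t /\ nonunits O t.
    apply: contrapT => h; apply: pO; apply: cO => //.
    rewrite e; apply: localization_min => // s hs ns.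
    apply: not_nonunit_unit; first exact: AO.
    by move=> nOs; apply: h; exists s; split=> //; rewrite e; exact: localization_unit.
  exists [:: t^-1]; split; first by apply/seq_consP; split=> //; case: ut.
  move=> T /lies_over_idP[_ nT] /seq_consP[Tt _].
  apply: unit_not_nonunit (nT _ nt); split=> //; first by case: ut.
  by apply: nonunits_sub; exact: nT.
Qed.

End Projective.

(** * Local rings and extensions of function fields *)

Section Morphism.
Variables (K L : fieldType) (phi : {rmorphism K -> L}).
Implicit Types (O Q : set K) (P : set L).

Lemma image_morph O x : (phi @` O) (phi x) <-> O x.
Proof. by split=> [[y hy /fmorph_inj <-]|hx] //; exists x. Qed.

Lemma image_nonunits O : nonunits (phi @` O) = phi @` nonunits O.
Proof.
apply/seteqP; split=> [z /nonunitsP[[x hx <-] h]|_ [x /nonunitsP[hx h] <-]].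
  exists x => //; apply/nonunitsP; split=> // hv; apply/eqP; rewrite -(fmorph_eq0 phi).
  by apply/eqP/h; rewrite -fmorphV; apply/image_morph.
apply/nonunitsP; split; first exact/image_morph.
by rewrite -fmorphV => /image_morph/h ->; rewrite rmorph0.
Qed.

Lemma image_subring O : subring O -> subring (phi @` O).
Proof.
move=> sO; apply/subringP; split.
- by exists 1; [exact: subring1|rewrite rmorph1].
- by move=> _ _ [x hx <-] [y hy <-]; exists (x - y); [exact: subringB|rewrite rmorphB].
- by move=> _ _ [x hx <-] [y hy <-]; exists (x * y); [exact: subringM|rewrite rmorphM].
Qed.

Lemma image_local O : local_ring O -> local_ring (phi @` O).
Proof.
move=> hO; have [sO mO] := (local_subring hO, local_ideal hO).
split; first exact: image_subring; rewrite image_nonunits; split.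
- by move=> _ [x hx <-]; exists x => //; exact: nonunits_sub.
- by exists 0; [exact: (ideal0 mO)|rewrite rmorph0].
- by move=> _ _ [x hx <-] [y hy <-]; exists (x + y); [exact: (idealD mO)|rewrite rmorphD].
- by move=> _ _ [x hx <-] [y hy <-]; exists (x * y); [exact: (ideal_mull mO)|rewrite rmorphM].
Qed.

Lemma image_regular_pair O b y : regular_pair O b y ->
  regular_pair (phi @` O) (phi b) (phi y).
Proof.
move=> rp; split.
- exact: image_local (rp_local rp).
- by rewrite fmorph_eq0 (rp_neq0 rp).
- move=> z; rewrite image_nonunits; split.
    move=> [x /(rp_gen rp)[u [v [hu hv ->]]] <-].
    by exists (phi u), (phi v); split; [exists u|exists v|rewrite rmorphD !rmorphM].
  move=> [_ [_ [[u hu <-] [v hv <-] ->]]]; exists (u * b + v * y).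
    by apply/(rp_gen rp); exists u, v.
  by rewrite rmorphD !rmorphM.
- move=> _ [a ha <-]; rewrite -rmorphM -!fmorph_div => /image_morph h.
  by apply/image_morph; exact: (rp_reg rp).
Qed.

Lemma preimage_nonunits P : nonunits (phi @^-1` P) = phi @^-1` nonunits P.
Proof.
apply/seteqP; split=> x /nonunitsP[hx h]; apply/nonunitsP; split=> //.
  by rewrite -fmorphV => /h ->; rewrite rmorph0.
by move=> hv; apply/eqP; rewrite -(fmorph_eq0 phi); apply/eqP/h; rewrite -fmorphV.
Qed.

Lemma preimage_subring P : subring P -> subring (phi @^-1` P).
Proof.
move=> sP; apply/subringP; split=> [|x y hx hy|x y hx hy].
- by rewrite /preimage /= rmorph1; exact: subring1.
- by rewrite /preimage /= rmorphB; exact: subringB.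
- by rewrite /preimage /= rmorphM; exact: subringM.
Qed.

Lemma preimage_local P : local_ring P -> local_ring (phi @^-1` P).
Proof.
move=> hP; have [sP mP] := (local_subring hP, local_ideal hP).
split; first exact: preimage_subring; rewrite preimage_nonunits; split.
- by move=> x /nonunits_sub.
- by rewrite /preimage /= rmorph0; exact: (ideal0 mP).
- by move=> x y hx hy; rewrite /preimage /= rmorphD; exact: (idealD mP).
- by move=> x y hx hy; rewrite /preimage /= rmorphM; exact: (ideal_mull mP).
Qed.

Lemma lies_over_preimage Q P : lies_over phi Q P -> lies_over idfun Q (phi @^-1` P).
Proof.
case=> h1 h2; apply/lies_over_idP; rewrite preimage_nonunits.
by split=> x hx; [apply: h1|apply: h2]; exists x.
Qed.

Lemma lies_over_unique (Y : set (set K)) Q Q' P : separated Y -> subring P ->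
  Y Q -> Y Q' -> lies_over phi Q P -> lies_over phi Q' P -> Q = Q'.
Proof.
move=> sep sP YQ YQ' /lies_over_preimage h /lies_over_preimage h'.
exact: (sep _ _ _ YQ YQ' (preimage_subring sP) h h').
Qed.

Lemma pullback_equation (Y : set (set K)) (C : divisor K) Q P f :
  separated Y -> local_ring P -> Y Q -> lies_over phi Q P ->
  subring Q -> Q f -> C Q = principal Q f ->
  pullback phi Y C P = principal P (phi f).
Proof.
move=> sep lP YQ QP sQ Qf e; have sP := local_subring lP.
have hI : ideal P (principal P (phi f)).
  by apply: principal_ideal => //; apply: QP.1; exists f.
apply/seteqP; split=> [w [Q' [YQ' Q'P]]|w hw].
  rewrite (lies_over_unique sep sP YQ' YQ Q'P QP) e; move: w.
  apply: ideal_gen_min => // _ [_ [a Qa <-] <-]; exists (phi a); last by rewrite rmorphM.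
  by apply: QP.1; exists a.
exists Q; split=> //; move: w hw => _ [a Pa <-] M [hM sM].
apply: (ideal_mulr hM) => //; apply: sM; exists f => //.
by rewrite e; exists 1; [exact: subring1|rewrite mulr1].
Qed.

End Morphism.

(** * Extraction of a root of a parameter *)

Section RootExtension.
Variables (L : fieldType) (O : set L) (b y w : L) (n : nat).
Hypotheses (rp : regular_pair O b y) (wn : w ^+ n.+1 = b).
Hypothesis free_powers : forall q : {poly L},
  poly_over O q -> (size q <= n.+1)%N -> q.[w] = 0 -> q = 0.

Let hO := rp_local rp.
Let sO := local_subring hO.
Let mO := local_ideal hO.
Let b0 := rp_neq0 rp.
Let B := subring_gen (O `|` [set w]).
Let hB : subring B := subring_gen_subring _.

Let w0 : w != 0.
Proof. by apply: contraNneq b0 => w0; rewrite -wn w0 expr0n. Qed.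

Let horner_ext p : poly_over O p -> B p.[w].
Proof. by move=> hp; rewrite /B (adjoinE sO); exists p. Qed.

Let Bw : B w.
Proof. by rewrite -[w]hornerX; apply: horner_ext; exact: poly_overX. Qed.

Let OB : O `<=` B.
Proof. by move=> a ha; apply: sub_gen_smallest; left. Qed.

(** The product of [q] and 'X, reduced modulo 'X^(n + 1) - b. *)
Let shift (q : {poly L}) : {poly L} := q * 'X - q`_n *: 'X^(n.+1) + (q`_n * b)%:P.

Let shift_over q : poly_over O q -> poly_over O (shift q).
Proof.
move=> hq; have Ob : O b := nonunits_sub (rp_nonunit1 rp).
apply: (poly_overD sO); last by apply: (poly_overC sO); exact: subringM.
apply: (poly_overB sO); first by apply: (poly_overM sO) => //; exact: poly_overX.
move=> i; rewrite coefZ; apply: (subringM sO) => //.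
exact: (poly_overXn sO _ (poly_overX sO)).
Qed.

Let shift_size (q : {poly L}) : (size q <= n.+1)%N -> (size (shift q) <= n.+1)%N.
Proof.
move=> sq; apply/leq_sizeP => -[//|i]; rewrite ltnS leq_eqVlt.
rewrite !coefE /= addr0 eqSS => /orP[/eqP <-|ni]; first by rewrite eqxx mulr1 subrr.
rewrite [_ == _]gtn_eqF // mulr0 subr0.
by move/leq_sizeP: sq; apply.
Qed.

Let shift_eval q : (shift q).[w] = w * q.[w].
Proof. by rewrite /shift !hornerS wn; ring. Qed.

Let reduced p : poly_over O p ->
  exists q, [/\ poly_over O q, (size q <= n.+1)%N & p.[w] = q.[w]].
Proof.
elim/poly_ind: p => [|p c IH] hp.
  by exists 0; split=> //; rewrite size_poly0.
have [|q [hq sq e]] := IH.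
  by move=> i; have := hp i.+1; rewrite coefD coefMX coefC addr0.
have hc : O c by have := hp 0%N; rewrite coefD coefMX coefC add0r.
exists (shift q + c%:P); split.
- by apply: (poly_overD sO); [exact: shift_over|exact: poly_overC].
- apply: leq_trans (size_polyD _ _) _; rewrite geq_max shift_size //= size_polyC.
  by case: (c == 0).
- by rewrite hornerMXaddC hornerD shift_eval hornerC e mulrC.
Qed.

(** The ring [B] is free over [O] with basis the powers of [w].  The maximal
    ideal over that of [O] is generated by [w] and [y], as [b] is a power of
    [w].  Modulo [w] the ring [B] is [O] modulo [b], where [y] is regular. *)
Lemma root_extension_regular_pair I : prime_ideal B I -> nonunits O `<=` I ->
  regular_pair (localization B I) w y.
Proof.
move=> hI nI; have [I0 nI1 mI] := hI.
have lP := localization_local hB hI; have sP := local_subring lP.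
have BP := sub_localization hB hI.
have Iw : I w.
  have : I (w ^+ n.+1) by rewrite wn; apply: nI; exact: rp_nonunit1 rp.
  elim: (n) => [//|m IH]; rewrite exprS => /mI[] //; exact: (subringX hB).
have nPw := localization_nonunits hB hI Iw.
have nPy := localization_nonunits hB hI (nI _ (rp_nonunit2 rp)).
split=> //.
- move=> x; split=> [/(localization_nonunitsP hI)[a [s [ha hs ns ->]]]|[u [v [hu hv ->]]]]; last first.
    by apply: (idealD (local_ideal lP)); apply: (ideal_mull (local_ideal lP)).
  have [_ _ sv] := localization_unit hB hI hs ns.
  have Ba := ideal_sub I0 ha; move: Ba ha; rewrite {1}/B (adjoinE sO) => -[p hp <-].
  have [q [ep eq]] := poly_constant_part p.
  have hq : poly_over O q by move=> i; rewrite eq; exact: hp.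
  rewrite ep hornerMXaddC => ha.
  have np0 : nonunits O p`_0.
    have [[p0 _ pv]|//] := unit_or_nonunit (hp 0%N).
    case: nI1; rewrite -(mulVf p0); apply: (ideal_mull I0); first exact: OB.
    have -> : p`_0 = q.[w] * w + p`_0 - q.[w] * w by ring.
    by apply: (idealB hB I0) => //; apply: (ideal_mull I0) => //; exact: horner_ext.
  have [u [v [hu hv e]]] := iffLR (rp_gen rp _) np0.
  exists ((q.[w] + u * w ^+ n) / s), (v / s); split.
  + apply: (subringM sP) => //; apply: BP; apply: (subringD hB); first exact: horner_ext.
    by apply: (subringM hB); [exact: OB|exact: (subringX hB)].
  + by apply: (subringM sP) => //; apply: BP; exact: OB.
  + by rewrite e -wn exprS; ring.
- move=> _ [a [s [ha hs ns ->]]] [c [t [hc ht nt e]]].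
  have s0 := prime_neq0 hI ns; have t0 := prime_neq0 hI nt.
  have [_ _ sv] := localization_unit hB hI hs ns.
  have [_ _ tv] := localization_unit hB hI ht nt.
  have : B (a * t) := subringM hB ha ht.
  rewrite {1}/B (adjoinE sO) => -[p' /reduced[p [hp sp ->]] ep].
  have : B (c * s) := subringM hB hc hs.
  rewrite {1}/B (adjoinE sO) => -[q' /reduced[q [hq sq ->]] eq].
  have e1 : y * p.[w] = w * q.[w].
    rewrite ep eq.
    have -> : y * (a * t) = a / s * y / w * (s * t * w) by field; rewrite s0 w0.
    by rewrite e; field.
  have z : y *: p - shift q = 0.
    apply: free_powers.
    + apply: (poly_overB sO); last exact: shift_over.
      move=> i; rewrite coefZ; apply: (subringM sO) => //.
      exact: (nonunits_sub (rp_nonunit2 rp)).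
    + apply: leq_trans (size_polyD _ _) _; rewrite size_polyN geq_max shift_size // andbT.
      exact: leq_trans (size_scale_leq _ _) sp.
    + by rewrite hornerD hornerN hornerZ shift_eval e1 subrr.
  have hb : O (p`_0 / b).
    apply: (rp_reg rp) => //; have /eqP := congr1 (fun r : {poly L} => r`_0) z.
    rewrite /shift !coefE /= mulr0 subr0 add0r subr_eq0 => /eqP e2.
    by rewrite [p`_0 * y]mulrC e2 mulfK.
  have [p1 [ep1 hp1]] := poly_constant_part p.
  have hp1' : poly_over O p1 by move=> i; rewrite hp1; exact: hp.
  rewrite (_ : _ / w = (p1.[w] + w ^+ n * (p`_0 / b)) * s^-1 * t^-1).
    apply: (subringM sP) => //; apply: (subringM sP) => //; apply: BP.
    apply: (subringD hB); first exact: horner_ext.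
    by apply: (subringM hB); [exact: (subringX hB)|exact: OB].
  have -> : a / s / w = (a * t) / (w * s * t) by field; rewrite s0 t0 w0.
  have ep0 : p`_0 = w ^+ n.+1 * (p`_0 / b) by rewrite wn mulrC divfK.
  by rewrite -ep {1}ep1 hornerMXaddC {1}ep0 exprS; field; rewrite b0 s0 t0 w0.
Qed.

End RootExtension.

(** * The sequence of local rings along a curve *)

(** The local rings of the points of the cluster determined by [b = 0]. *)
Fixpoint tower_point (K : fieldType) (O : set K) (b y : K) (i : nat) : set K :=
  if i is j.+1 then origin_point (tower_point O b y j) (b / y ^+ j) y else O.

Definition order_at (K : fieldType) (O : set K) (f : K) : nat :=
  xget 0%N [set d | ideal_pow O (nonunits O) d f /\ ~ ideal_pow O (nonunits O) d.+1 f].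

(** The equations of the successive strict transforms of the divisor of [f]. *)
Fixpoint tower_equation (K : fieldType) (O : set K) (b y f : K) (i : nat) : K :=
  if i is j.+1 then
    tower_equation O b y f j / y ^+ order_at (tower_point O b y j) (tower_equation O b y f j)
  else f.

Definition tower_order (K : fieldType) (O : set K) (b y f : K) (i : nat) : nat :=
  order_at (tower_point O b y i) (tower_equation O b y f i).

Section Tower.
Variables (K : fieldType) (O : set K) (b y : K).
Hypothesis rp : regular_pair O b y.

Let y0 := rp_neq0' rp.
Let T i := tower_point O b y i.

Let coordinate_step i : b / y ^+ i / y = b / y ^+ i.+1.
Proof. by rewrite exprSr invfM mulrA. Qed.

Lemma tower_regular_pair i : regular_pair (T i) (b / y ^+ i) y.
Proof.
elim: i => [|i IH]; first by rewrite /T /= expr0 divr1.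
by rewrite -coordinate_step; exact: origin_point_regular_pair.
Qed.

Lemma sub_tower_point i : O `<=` T i /\ nonunits O `<=` nonunits (T i).
Proof.
elim: i => [|i [IH IH']]; first by split.
have rpi := tower_regular_pair i; split.
  exact: subset_trans IH (sub_origin_point rpi).
exact: subset_trans IH' (nonunits_sub_origin_point rpi).
Qed.

(** This allows the coefficients of the leading forms at any point of the tower
    to be taken in [O]. *)
Lemma tower_residue i x : T i x -> exists2 c, O c & nonunits (T i) (x - c).
Proof.
elim: i x => [|i IH] x hx.
  exists x => //; rewrite subrr; exact: (ideal0 (local_ideal (rp_local rp))).
have rpi := tower_regular_pair i; have rpS := tower_regular_pair i.+1.
have [c /IH[e he nce] nxc] := origin_point_residue rpi hx; exists e => //.
rewrite (_ : x - e = (x - c) + (c - e)); last by ring.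
apply: (idealD (local_ideal (rp_local rpS))) => //.
exact: (nonunits_sub_origin_point rpi).
Qed.

Lemma tower_equationE f i :
  tower_equation O b y f i = f / y ^+ (\sum_(j < i) tower_order O b y f j).
Proof.
elim: i => [|i IH]; first by rewrite big_ord0 expr0 divr1.
by rewrite big_ord_recr /= exprD invfM mulrA -IH.
Qed.

(* V is to be the trace on K of the valuation ring of the exceptional curve of
   the blowing up of the ramification point P, where b / y ^+ n.+1 is the power
   (w / y) ^+ n.+1 of a transcendental residue. *)
Variables (V : set K) (n : nat).
Hypotheses (hV : local_ring V) (OV : O `<=` V) (nVy : nonunits V y).
Hypothesis Vb : V (b / y ^+ n.+1).
Hypothesis unit_value : forall p, poly_over O p -> ~ poly_over (nonunits O) p ->
  unit_of V p.[b / y ^+ n.+1].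

Let sV := local_subring hV.
Let mV := local_ideal hV.
Let Vy := nonunits_sub nVy.

Lemma tower_coordinate i : (i <= n)%N -> V (b / y ^+ i.+1).
Proof.
move=> i_n; rewrite (_ : _ / _ = b / y ^+ n.+1 * y ^+ (n - i)).
  by apply: (subringM sV) => //; exact: subringX.
by rewrite -{1}(subnK i_n) -addnS exprD; field; rewrite !expf_neq0.
Qed.

Lemma sub_valuation i : (i <= n)%N ->
  T i `<=` V /\ forall x, nonunits (T i) x -> V (x / y).
Proof.
elim: i => [|i IH] i_n.
  split=> // x /(rp_gen rp)[u [v [hu hv ->]]]; rewrite mulrDl mulfK // -mulrA.
  apply: (subringD sV); last exact: OV.
  by apply: (subringM sV); [exact: OV|rewrite -(expr1 y); exact: tower_coordinate].
have [TV _] := IH (ltnW i_n); have rpi := tower_regular_pair i.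
have TV' : T i.+1 `<=` V.
  apply: (origin_point_min rpi) => //; rewrite coordinate_step.
  rewrite -(divfK y0 (b / _)) coordinate_step.
  by apply: (ideal_mull mV) => //; exact: tower_coordinate.
split=> // x /(rp_gen (tower_regular_pair i.+1))[u [v [hu hv ->]]].
rewrite mulrDl mulfK // -mulrA coordinate_step.
apply: (subringD sV); last exact: TV'.
by apply: (subringM sV); [exact: TV'|exact: tower_coordinate].
Qed.

Lemma power_valuation i d f : (i <= n)%N ->
  ideal_pow (T i) (nonunits (T i)) d f -> V (f / y ^+ d).
Proof.
move=> i_n /(ideal_powP (tower_regular_pair i))[p [hp sp ->]].
rewrite coordinate_step mulrAC divff ?expf_neq0 // mul1r.
apply: (horner_over sV); first exact: tower_coordinate.
exact: poly_over_sub (sub_valuation i_n).1 hp.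
Qed.

(** At the last point of the tower the coordinate of the exceptional curve is
    [b / y ^+ n.+1], a transcendental residue of [V].  The coefficients of the
    leading form of [f] can be taken in [O], as the residue field is that of
    [O], and the value of the form is then a unit of [V]. *)
Lemma last_valuation d f : ideal_pow (T n) (nonunits (T n)) d f ->
  ~ ideal_pow (T n) (nonunits (T n)) d.+1 f -> unit_of V (f / y ^+ d).
Proof.
have rpn := tower_regular_pair n; move=> fd /(leading_form rpn fd)[p [hp sp -> np]].
rewrite coordinate_step mulrAC divff ?expf_neq0 // mul1r.
have /choice[r hr] i : exists r, O r /\ nonunits (T n) (p`_i - r).
  by have [c ? ?] := tower_residue (hp i); exists c.
pose q := \poly_(i < size p) r i.
have hq : poly_over O q.
  move=> i; rewrite coef_poly; case: ifP => _; first by case: (hr i).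
  exact: (subring0 (local_subring (rp_local rp))).
have hpq : poly_over (nonunits (T n)) (p - q).
  move=> i; rewrite coefB coef_poly; case: ltnP => h; first by case: (hr i).
  by rewrite nth_default // subrr; exact: (ideal0 (local_ideal (rp_local rpn))).
rewrite -(subrK q p) hornerD addrC; apply: (unit_ofD hV).
  apply: unit_value => // nq; apply: np => i; rewrite -(subrK q p) coefD.
  apply: (idealD (local_ideal (rp_local rpn))) => //.
  exact: (sub_tower_point n).2.
rewrite horner_coef; apply: (ideal_sum mV) => i _; apply: (ideal_mulr mV).
  by apply: (subringX sV).
rewrite -(divfK y0 (_`_i)); apply: (ideal_mull mV) => //.
exact: (sub_valuation (leqnn n)).2.
Qed.

Lemma valuation_le f m d : unit_of V (f / y ^+ m) -> V (f / y ^+ d) -> (d <= m)%N.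
Proof.
move=> fm h; rewrite leqNgt; apply/negP => md.
have [fm0 _ fmv] := fm; apply: (unit_not_nonunit _ nVy); split=> //.
rewrite (_ : y^-1 = f / y ^+ d * (f / y ^+ m)^-1 * y ^+ (d - m.+1)).
  by apply: (subringM sV); [exact: (subringM sV)|exact: (subringX sV)].
have f0 : f != 0 by apply: contraNneq fm0 => ->; rewrite mul0r.
rewrite -{1}(subnKC md) exprD exprS; field.
by rewrite f0 y0 !expf_neq0.
Qed.

Variables (f : K) (m : nat).
Hypotheses (Of : O f) (fm : unit_of V (f / y ^+ m)).

Let F i := tower_equation O b y f i.

(** The multiplicity exists because the valuation of [f] in [V], which is [m],
    bounds the adic order of each of the successive equations. *)
Lemma tower_orderP i : (i <= n)%N -> T i (F i) /\
  (ideal_pow (T i) (nonunits (T i)) (tower_order O b y f i) (F i) /\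
   ~ ideal_pow (T i) (nonunits (T i)) (tower_order O b y f i).+1 (F i)).
Proof.
have main j : (j <= n)%N -> T j (F j) ->
    ideal_pow (T j) (nonunits (T j)) (tower_order O b y f j) (F j) /\
    ~ ideal_pow (T j) (nonunits (T j)) (tower_order O b y f j).+1 (F j).
  move=> jn hF; have rpj := tower_regular_pair j.
  pose P d := `[< ideal_pow (T j) (nonunits (T j)) d (F j) >].
  have P0 : P 0%N.
    apply/asboolP/(ideal_powP rpj); exists (F j)%:P; split.
    - exact: (poly_overC (local_subring (rp_local rpj)) hF).
    - by rewrite size_polyC; case: (F j == 0).
    - by rewrite hornerC expr0 mul1r.
  have bound d : P d -> (d <= m)%N.
    move=> /asboolP/(power_valuation jn); rewrite /F tower_equationE -mulrA -invfM -exprD.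
    by move/(valuation_le fm); apply: leq_trans; exact: leq_addl.
  case: (ex_maxnP (ex_intro (fun d => P d) 0%N P0) bound) => d /asboolP hd dmax.
  apply: (@xgetPex _ 0%N [set d | ideal_pow (T j) (nonunits (T j)) d (F j) /\
    ~ ideal_pow (T j) (nonunits (T j)) d.+1 (F j)]).
  exists d; split=> // hdS.
  by have := dmax d.+1; rewrite ltnn => h; have := h (asboolT hdS).
move=> i_n; suff hF : T i (F i) by split=> //; exact: main.
elim: i i_n => [//|i IH] i_n; have rpi := tower_regular_pair i.
have [hd _] := main i (ltnW i_n) (IH (ltnW i_n)).
have [p [hp sp e]] := iffLR (ideal_powP rpi _ _) hd.
have -> : F i.+1 = p.[b / y ^+ i / y].
  by rewrite /F /= -/(tower_order O b y f i) -/(F i) e mulrAC divff ?expf_neq0 // mul1r.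
apply: (sub_localization (chart_of (T i) y).1 (origin_prime_prime rpi)).
exact: (chart_horner rpi).
Qed.

(** Both [y ^+ m] and the power of [y] by the sum of the multiplicities are
    associated with [f] in [V], in which [y] is not invertible. *)
Lemma sum_tower_order : m = (\sum_(j < n.+1) tower_order O b y f j)%N.
Proof.
have [_ [hd nd]] := tower_orderP (leqnn n); set s := (\sum_(j < n.+1) _)%N.
have us : unit_of V (f / y ^+ s).
  have := last_valuation hd nd; rewrite /F tower_equationE -mulrA -invfM -exprD.
  by rewrite /s big_ord_recr.
apply/eqP; rewrite eqn_leq; apply/andP; split.
  by apply: (valuation_le us); case: fm.
by apply: (valuation_le fm); case: us.
Qed.

End Tower.

(** * The cluster determined by the branch divisor *)

Section Cluster.
Variables (K : fieldType) (n : nat) (Y : set (set K)) (Q : nat -> set K).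
Variables (B : divisor K) (b y : K).
Hypothesis bl : blowable Y (Q 1%N) b y.
Hypothesis generization : forall p J, Y p -> prime_ideal p J -> Y (localization p J).
Hypotheses (eB : effective_divisor Y B) (bB : local_equation B (Q 1%N) b).
Hypothesis b_prime : forall a c, Q 1%N a -> Q 1%N c ->
  Q 1%N (a * c / b) -> Q 1%N (a / b) \/ Q 1%N (c / b).
Hypothesis clQ : cluster_of n Y B Q.

Let O := Q 1%N.
Let rp := bl_pair bl.
Let hO := rp_local rp.
Let sO := local_subring hO.
Let b0 := rp_neq0 rp.
Let y0 := rp_neq0' rp.
Let nb := rp_nonunit1 rp.
Let T i := tower_point O b y i.

(* The generic point of the component of the branch curve through O. *)
Let beta := localization O (principal O b).

Let principal_prime : prime_ideal O (principal O b).
Proof.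
split; first exact: principal_ideal sO (nonunits_sub nb).
  by move/(principalP _ _ b0); rewrite div1r => h; case: (unit_not_nonunit _ nb); split=> //; exact: nonunits_sub.
move=> a c ha hc /(principalP _ _ b0)/(b_prime ha hc)[] h; [left|right];
exact/principalP.
Qed.

Let beta_local : local_ring beta := localization_local sO principal_prime.

Let O_beta : O `<=` beta := sub_localization sO principal_prime.

Let b_beta : nonunits beta b.
Proof.
apply: (localization_nonunits sO principal_prime).
by exists 1; [exact: subring1|rewrite mulr1].
Qed.

Let y_beta : unit_of beta y.
Proof.
apply: (localization_unit sO principal_prime); first exact: (nonunits_sub (rp_nonunit2 rp)).
move/(principalP _ _ b0) => h; case: (unit_not_nonunit _ nb); split=> //.
  exact: nonunits_sub.
by rewrite -div1r; apply: (rp_reg rp); [exact: subring1|rewrite mul1r].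
Qed.

(** The strict transforms of the branch curve contain its generic point
    [beta], hence pass through its specializations, such as the points of the
    tower; as the cluster has a single point over each of its points, it is
    the tower. *)
Lemma cluster_tower i : (i < n)%N ->
  blowable (blowup_tower Y Q i) (Q i.+1) (b / y ^+ i) y /\ Q i.+1 = T i.
Proof.
case: clQ => Bt [[Bt0 hBt] hQ].
suff main : (i < n)%N ->
    [/\ blowable (blowup_tower Y Q i) (Q i.+1) (b / y ^+ i) y /\ Q i.+1 = T i,
        blowup_tower Y Q i beta /\ T i `<=` beta, effective_divisor (blowup_tower Y Q i) (Bt i)
      & Bt i beta = principal beta b] by case/main.
have sbeta := local_subring beta_local.
elim: i => [|i IH] i_n.
  split.
  - by rewrite expr0 divr1; split.
  - by split=> //; exact: generization (bl_point bl) principal_prime.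
  - by rewrite Bt0.
  - have [g [U [oU UO hU]]] := eB.1 _ (bl_point bl).
    have [g0 e] := hU _ UO; have [_ e'] := bB.
    have Yb := generization (bl_point bl) principal_prime.
    have [_ eb] := hU _ (open_generization oU UO Yb O_beta).
    rewrite Bt0 eb; have Ogb : O (g / b).
      by apply/(principalP _ _ b0); rewrite -e' e; exists 1; [exact: subring1|rewrite mulr1].
    have Obg : O (b / g).
      by apply/(principalP _ _ g0); rewrite -e e'; exists 1; [exact: subring1|rewrite mulr1].
    rewrite (_ : g = b * (g / b)); last by rewrite mulrC divfK.
    by rewrite principal_unit ?mulf_neq0 ?invr_eq0 ?invf_div //; exact: O_beta.
have [[bli eQ] [Tbeta sTbeta] eBi Bbeta] := IH (ltnW i_n).
have step : b / y ^+ i / y = b / y ^+ i.+1 by rewrite exprSr invfM mulrA.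
have bl' := blowup_blowable bli; rewrite step in bl'.
have [strB offB _] := hBt i.+1 i_n.
have beta_ne : beta <> Q i.+1.
  move=> e; apply: (unit_not_nonunit y_beta); rewrite e.
  exact: (rp_nonunit2 (bl_pair bli)).
have [Tbeta' nE] := blowup_not_exceptional bli Tbeta beta_ne.
have sub' : T i.+1 `<=` beta.
  apply: (origin_point_min (tower_regular_pair rp i) beta_local sTbeta).
  rewrite step; case: y_beta => _ _ yv; apply: (ideal_mulr (local_ideal beta_local)) => //.
  by rewrite -exprVn; exact: (subringX sbeta).
have Bbeta' : Bt i.+1 beta = principal beta b.
  rewrite offB // -Bbeta; apply: pullback_id => //.
  exact: (bl_separated bli).
have eT : origin_point (Q i.+1) (b / y ^+ i) y = T i.+1 by rewrite eQ.
rewrite eT in bl'.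
have suppB : supp (blowup_tower Y Q i.+1) (Bt i.+1) (T i.+1).
  split; first exact: (bl_point bl').
  have [g [U [oU UT hU]]] := strB.1 _ (bl_point bl').
  have [g0 ->] := hU _ UT; move=> /(principalP _ _ g0); rewrite div1r => gv.
  have [_ eb] := hU _ (open_generization oU UT Tbeta' sub').
  have : principal beta b 1.
    by rewrite -Bbeta' eb; apply/(principalP _ _ g0); rewrite div1r; exact: sub'.
  move/(principalP _ _ b0); rewrite div1r => bv.
  by case: (unit_not_nonunit _ b_beta); split=> //; exact: nonunits_sub.
have eQ' : Q i.+2 = T i.+1.
  have /esym e := hQ i.+1 i_n.
  have : (exceptional_curve (blowup_tower Y Q i) (Q i.+1)
      `&` supp (blowup_tower Y Q i.+1) (Bt i.+1)) (T i.+1).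
    by split=> //; rewrite -eT; exact: origin_point_exceptional bli.
  by rewrite -e.
by split=> //; rewrite eQ'.
Qed.

Variables (C : divisor K) (f : K).
Hypotheses (eC : effective_divisor Y C) (fC : local_equation C O f).
Hypothesis orderP : forall i, (i < n)%N ->
  ideal_pow (T i) (nonunits (T i)) (tower_order O b y f i) (tower_equation O b y f i) /\
  ~ ideal_pow (T i) (nonunits (T i)) (tower_order O b y f i).+1 (tower_equation O b y f i).

Fixpoint tower_transform (i : nat) : divisor K :=
  if i is j.+1 then proper_transform (blowup_tower Y Q j) (Q i) (tower_transform j)
    (tower_equation O b y f j) (tower_order O b y f j)
  else C.

Lemma tower_transformP i : (i < n)%N ->
  effective_divisor (blowup_tower Y Q i) (tower_transform i) /\
  local_equation (tower_transform i) (Q i.+1) (tower_equation O b y f i).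
Proof.
elim: i => [//|i IH] i_n; have [eCi eqi] := IH (ltnW i_n).
have [bli eQ] := cluster_tower (ltnW i_n); have [_ eQ'] := cluster_tower i_n.
have [hd _] := orderP (ltnW i_n); rewrite -eQ in hd.
split; first exact: (proper_transform_effective bli eCi eqi hd).
have -> : Q i.+2 = origin_point (Q i.+1) (b / y ^+ i) y by rewrite eQ' eQ.
exact: (proper_transform_origin bli _ eqi).
Qed.

Lemma passes_through_cluster :
  passes_through n Y Q C (fun i => tower_order O b y f i.-1).
Proof.
exists tower_transform; split; first split=> // -[//|i] /andP[_ i_n].
  have [eCi eqi] := tower_transformP (ltnW i_n).
  have [bli eQ] := cluster_tower (ltnW i_n).
  have [hd nd] := orderP (ltnW i_n); rewrite -eQ in hd nd.
  exact: (proper_transform_strict bli eCi eqi hd nd).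
move=> [//|i] /andP[_ i_n] /=; have [_ [_ eqi]] := tower_transformP i_n.
have [bli eQ] := cluster_tower i_n; apply/(multiplicity_equation _ (bl_pair bli) eqi).
by rewrite eQ; exact: orderP.
Qed.

End Cluster.

(** * Proof of the multiplicity formula *)

Theorem proposition5p3 (R : realType) (K L : fieldType)
    (iota : {rmorphism R[i] -> K}) (phi : {rmorphism K -> L})
    (n : nat) (n_gt0 : (0 < n)%N)
    (Y : set (set K)) (X : set (set L)) (B : divisor K)
    (Y_surface : smooth_projective_surface iota Y)
    (X_covering : cyclic_covering phi n Y B X) :
  holds_at_generic_point X (preimage_supp phi Y X B) (fun P : set L =>
    forall Q : nat -> set K,
      closed_point Y (Q 1%N) -> lies_over phi (Q 1%N) P -> cluster_of n Y B Q ->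
    forall (C : divisor K) (m : nat),
      effective_divisor Y C ->
      multiplicity (pullback phi Y C) P m ->
    exists mi : nat -> nat,
      passes_through n Y Q C mi /\ m = (\sum_(1 <= i < n.+1) mi i)%N).
Proof.
case: n n_gt0 X_covering => // n _ X_covering.
exists X; split; first by split=> // p Xp; exists [::].
  by move=> V [VX _] [p [Vp hp]]; exists p; split=> //; split=> //; exact: VX.
move=> P _ [XP [_ [Q0 [YQ0 suppQ0] Q0P]]] Q cO QP clQ C m eC multD.
have [[N [x [_ _ eY]]] smoothY] := Y_surface.
have sepY : separated Y by rewrite eY; exact: projective_separated.
have [[eB simpleB] _ [M [h [z [_ [h0 linB] zn freeL eX]]]]] := X_covering.
move: XP; rewrite eX => -[O [g [YO [g0 gM] [I [hI nI] eP]]]].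
set A := subring_gen _ in hI eP.
have hA : subring A := subring_gen_subring _.
have lP : local_ring P by rewrite -eP; exact: localization_local.
have sP := local_subring lP.
have AP : A `<=` P by rewrite -eP; exact: sub_localization.
have phiP a : O a -> P (phi a).
  by move=> ha; apply: AP; apply: sub_gen_smallest; left; exists a.
have OP : lies_over phi O P.
  split=> _ [a ha <-]; first exact: phiP.
  by rewrite -eP; apply: localization_nonunits => //; apply: nI; exists a.
have [YQ1 _] := cO.
have eO : O = Q 1%N := lies_over_unique sepY sP YO YQ1 OP QP.
have eQ0 : Q0 = Q 1%N := lies_over_unique sepY sP YQ0 YQ1 Q0P QP.
rewrite eQ0 in suppQ0; rewrite eO in phiP OP YO gM.
have sQ1 : subring (Q 1%N) by case: (smoothY _ cO) => /local_subring.
have [b0 bB] := linB _ _ YO (conj g0 gM); set b := h * g ^+ n.+1 in b0 bB.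
have nb : nonunits (Q 1%N) b.
  have Ob : Q 1%N b.
    by apply: (eB.2 _ YO); rewrite bB; exists 1; [exact: (subring1 sQ1)|rewrite mulr1].
  apply/nonunitsP; split=> // bv; case: suppQ0.
  by rewrite bB; apply/(principalP _ _ b0); rewrite div1r.
have nb2 : ~ ideal_pow (Q 1%N) (nonunits (Q 1%N)) 2 b.
  have [_ hB2] := simpleB _ cO (conj YO suppQ0); apply: contra_not hB2 => hb.
  rewrite bB => _ [a ha <-].
  exact: (ideal_mulr (ideal_pow_ideal 2 sQ1)).
have [y rp b_prime] := regular_parameter (smoothY _ cO) nb nb2.
have bl : blowable Y (Q 1%N) b y by rewrite eY; apply: projective_blowable => //; rewrite -eY.
have gen p J : Y p -> prime_ideal p J -> Y (localization p J).
  by rewrite eY; exact: projective_generization.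
set w := phi g * z in A hI eP hA AP.
have wn : w ^+ n.+1 = phi b by rewrite exprMn zn rmorphM rmorphXn mulrC.
(* The coordinates in the powers of w are those in the powers of z, up to the
   powers of g. *)
have freew (q : {poly L}) : poly_over (phi @` Q 1%N) q -> (size q <= n.+1)%N ->
    q.[w] = 0 -> q = 0.
  move=> hq sq qw0.
  have /choice[r hr] i : exists r, phi r = q`_i by have [c _ e] := hq i; exists c.
  have [a [_ ua]] := freeL 0.
  have e1 : a = [ffun i : 'I_n.+1 => r i * g ^+ i].
    apply: ua; rewrite -[LHS]qw0 (horner_coef_wide _ sq); apply: eq_bigr => i _.
    by rewrite ffunE rmorphM rmorphXn hr /w exprMn mulrA.
  have e2 : a = [ffun => 0].
    by apply: ua; rewrite big1 // => i _; rewrite ffunE rmorph0 mul0r.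
  apply/polyP => i; rewrite coef0; have [i_n|n_i] := ltnP i n.+1; last first.
    by move/leq_sizeP: sq; apply.
  have := congr1 (fun F : {ffun 'I_n.+1 -> K} => F (Ordinal i_n)) (etrans (esym e1) e2).
  rewrite !ffunE /= => /eqP; rewrite mulf_eq0 (negPf (expf_neq0 _ g0)) orbF => /eqP ri.
  by rewrite -hr ri rmorph0.
have rpP : regular_pair P w (phi y).
  rewrite -eP /A eO; apply: (root_extension_regular_pair (image_regular_pair phi rp) wn freew).
    by rewrite -eO.
  by rewrite image_nonunits -eO.
(* The valuation ring of the exceptional curve over the ramification point. *)
set VL := except_point P w (phi y); have lVL : local_ring VL := except_point_local rpP.
have PVL : P `<=` VL := sub_except_point rpP.
have unitV u : unit_of VL (phi u) -> unit_of (phi @^-1` VL) u.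
  case=> u0 hu hv; split=> //; first by rewrite -(fmorph_eq0 phi).
  by rewrite /preimage /= fmorphV.
have [f [U [_ UQ /(_ _ UQ)[f0 fC]]]] := eC.1 _ YO.
have Of : Q 1%N f.
  by apply: (eC.2 _ YO); rewrite fC; exists 1; [exact: subring1|rewrite mulr1].
have pullC := pullback_equation sepY lP YO OP sQ1 Of fC.
have [fm nfm] := iffLR (multiplicity_equation _ rpP pullC) multD.
have y0 := rp_neq0' rp.
have Vfm : unit_of (phi @^-1` VL) (f / y ^+ m).
  have [p [hp _ ep np]] := leading_form rpP fm nfm; apply: unitV.
  rewrite fmorph_div rmorphXn ep mulrAC divff ?mul1r; first exact: (except_point_unit rpP).
  by rewrite expf_neq0 // fmorph_eq0.
have OV : Q 1%N `<=` phi @^-1` VL by move=> a /phiP/PVL.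
have nVy : nonunits (phi @^-1` VL) y.
  rewrite preimage_nonunits; apply: (nonunits_sub_except_point rpP).
  exact: (rp_nonunit2 rpP).
have bw : phi (b / y ^+ n.+1) = (w / phi y) ^+ n.+1.
  by rewrite fmorph_div rmorphXn -wn expr_div_n.
have Vb : (phi @^-1` VL) (b / y ^+ n.+1).
  rewrite /preimage /= bw; apply: (subringX (local_subring lVL)).
  exact: (except_point_coordinate rpP).
have unit_value p : poly_over (Q 1%N) p -> ~ poly_over (nonunits (Q 1%N)) p ->
    unit_of (phi @^-1` VL) p.[b / y ^+ n.+1].
  move=> hp np; apply: unitV; rewrite -horner_map bw -hornerXn -horner_comp.
  have cq i : (map_poly phi p \Po 'X^(n.+1))`_i
      = if (n.+1 %| i)%N then phi p`_(i %/ n.+1) else 0.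
    by rewrite coef_comp_poly_Xn // coef_map.
  apply: (except_point_unit rpP) => [i|nq].
    by rewrite cq; case: ifP => _; [exact: phiP|exact: subring0].
  apply: np => i; have := nq (i * n.+1)%N; rewrite cq dvdn_mull // mulnK // => ni.
  have [ui|//] := unit_or_nonunit (hp i); case: (unit_not_nonunit _ ni).
  case: ui => p0 _ pv; split; [by rewrite fmorph_eq0|exact: phiP|].
  by rewrite -fmorphV; exact: phiP.
have lV := preimage_local phi lVL.
exists (fun i => tower_order (Q 1%N) b y f i.-1); split.
  apply: (passes_through_cluster bl gen eB (conj b0 bB) b_prime clQ eC (conj f0 fC)) => i i_n.
  exact: (tower_orderP rp lV OV nVy Vb Of Vfm i_n).2.
by rewrite big_add1 big_mkord /=; exact: (sum_tower_order rp lV OV nVy Vb unit_value Of Vfm).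
Qed.
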